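(* Order the simple $\mathcal{A}_1$-modules as $S_1=S_\epsilon$, $S_2=S_{\operatorname{sgn}}$, $S_3=S_{\operatorname{st}}(\mathrm{i})$, $S_4=S_{\operatorname{st}}(-\mathrm{i})$, $S_5=S_{\operatorname{st}}(\frac{\mathrm{i}}3)$, $S_6=S_{\operatorname{st}}(-\frac{\mathrm{i}}3)$. Then the Ext-quiver (Gabriel quiver) of $\mathcal{A}_1$ has vertices $1,\dots,6$ and exactly the following arrows, each with multiplicity one: $1\to2$, $2\to1$, $1\to3$, $1\to4$, $3\to2$, $4\to2$, $2\to5$, $2\to6$, $5\to1$, $6\to1$.
   Context: $\Bbbk$ is an algebraically closed field of characteristic zero, $\mathrm{i}=\sqrt{-1}\in\Bbbk$. $\mathcal{A}_1$ is the 72-dimensional Hopf algebra generated as an algebra by $H_t$ ($t\in\mathbb{S}_3$) and $a_{12},a_{13},a_{23}$ (indexed by the transpositions of $\mathbb{S}_3$; $H_{12}=H_{(12)}$, etc.), with relations $H_e=1$, $H_tH_s=H_{ts}$; $H_ta_i=\operatorname{sgn}(t)a_{tit^{-1}}H_t$; $a_{12}^2=0$; $a_{12}a_{23}+a_{23}a_{13}+a_{13}a_{12}=1-H_{12}H_{23}$. Since $a_{13}=-H_{23}a_{12}H_{23}$ and $a_{23}=-H_{13}a_{12}H_{13}$, a module is determined by the $\mathbb{S}_3$-action (via $t\mapsto H_t$) and the action of $a_{12}$. $S_\epsilon$, $S_{\operatorname{sgn}}$ are the one-dimensional modules where $H_t$ acts by the trivial, resp. sign, character and all $a_i$ act by $0$.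 The standard representation $W_{\operatorname{st}}$ of $\mathbb{S}_3$ has canonical basis $\{v,w\}$ with $H_{12}v=w$, $H_{12}w=v$; $H_{23}v=v-w$, $H_{23}w=-w$; $H_{13}v=-v$, $H_{13}w=-v+w$. $S_{\operatorname{st}}(\theta)$ is $W_{\operatorname{st}}$ with $a_{12}v=a_{12}w=\theta(v-w)$ for $\theta=\pm\mathrm{i}$, and with $a_{12}v=\theta(v+w)$, $a_{12}w=-\theta(v+w)$ for $\theta=\pm\frac{\mathrm{i}}{3}$. These six modules form a complete list of simple $\mathcal{A}_1$-modules. The Ext-quiver of a finite-dimensional algebra $B$ with simple modules $S_1,\dots,S_n$ has vertices $1,\dots,n$ and $\dim\operatorname{Ext}^1_B(S_i,S_j)$ arrows from $i$ to $j$, where $\operatorname{Ext}^1_B(S_i,S_j)$ classifies exact sequences $0\to S_j\to V\to S_i\to0$. *)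

(* Defs.v *)
From HB Require Import structures.
From mathcomp Require Import all_boot all_order all_algebra all_fingroup.
From mathcomp Require Import ring.
From mathcomp Require Import boolp.

Set Implicit Arguments.
Unset Strict Implicit.
Unset Printing Implicit Defensive.

Import GRing.Theory.
Local Open Scope ring_scope.


Definition simple_mod (R : pzRingType) (V : lmodType R) : Prop :=
  (exists v : V, v != 0) /\
  forall U : {pred V}, submod_closed U -> (U =i pred1 0) \/ (U =i predT).

Definition iso_mod (R : pzRingType) (V W : lmodType R) : Prop :=
  exists f : {linear V -> W}, bijective f.

Definition complete_simples (R : pzRingType) (n : nat)
    (S : 'I_n -> lmodType R) : Prop :=
  [/\ forall i, simple_mod (S i),
      forall i j, iso_mod (S i) (S j) -> i = j
    & forall V : lmodType R, simple_mod V -> exists i, iso_mod V (S i)].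

Record extension (R : pzRingType) (M N : lmodType R) := Extension {
  ext_mid : lmodType R;
  ext_inj : {linear N -> ext_mid};
  ext_proj : {linear ext_mid -> M};
  ext_injP : injective ext_inj;
  ext_projP : forall m, exists e, ext_proj e = m;
  ext_exact : forall e, ext_proj e = 0 <-> exists n, e = ext_inj n
}.

(* A morphism of short exact sequences whose outer components are f and g. *)
Definition ext_morph (R : pzRingType) (M N M' N' : lmodType R)
    (f : N -> N') (g : M -> M')
    (E : extension M N) (E' : extension M' N') : Prop :=
  exists u : {linear ext_mid E -> ext_mid E'},
    (forall n, u (ext_inj E n) = ext_inj E' (f n)) /\
    (forall e, ext_proj E' (u e) = g (ext_proj E e)).

Definition ext_equiv (R : pzRingType) (M N : lmodType R)
  (E F : extension M N) : Prop := ext_morph id id E F.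

Section DirectSum.
Variables (R : pzRingType) (M N M' N' : lmodType R).
Variables (E : extension M N) (F : extension M' N').

Definition dsum_inj (n : N * N') : ext_mid E * ext_mid F :=
  (ext_inj E n.1, ext_inj F n.2).
Definition dsum_proj (e : ext_mid E * ext_mid F) : M * M' :=
  (ext_proj E e.1, ext_proj F e.2).

Fact dsum_inj_linear : linear dsum_inj.
Proof. by move=> a x y; rewrite /dsum_inj /= !linearP. Qed.
Fact dsum_proj_linear : linear dsum_proj.
Proof. by move=> a x y; rewrite /dsum_proj /= !linearP. Qed.

HB.instance Definition _ := GRing.isLinear.Build R _ _ _ dsum_inj dsum_inj_linear.
HB.instance Definition _ := GRing.isLinear.Build R _ _ _ dsum_proj dsum_proj_linear.

Fact dsum_injP : injective dsum_inj.
Proof. by move=> [x y] [x' y'] [/ext_injP-> /ext_injP->]. Qed.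
Fact dsum_projP m : exists e, dsum_proj e = m.
Proof.
case: m => m m'; have [e <-] := ext_projP E m; have [e' <-] := ext_projP F m'.
by exists (e, e').
Qed.
Fact dsum_exact e : dsum_proj e = 0 <-> exists n, e = dsum_inj n.
Proof.
case: e => e e'; split=> [[]|[[n n'] [-> ->]]].
  by move=> /ext_exact[n ->] /ext_exact[n' ->]; exists (n, n').
congr (_, _); apply/ext_exact; first by exists n.
by exists n'.
Qed.

Definition ext_dsum : extension (M * M')%type (N * N')%type :=
  @Extension R _ _ _ dsum_inj dsum_proj dsum_injP dsum_projP dsum_exact.
End DirectSum.

(* G represents the Baer sum of E and F: pull (push (E (+) F) along the sum
   map N * N -> N) back along the diagonal M -> M * M. *)
Definition baer_sum (R : pzRingType) (M N : lmodType R)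
    (E F G : extension M N) : Prop :=
  exists X : extension (M * M)%type N,
    ext_morph (fun n => n.1 + n.2) id (ext_dsum E F) X /\
    ext_morph id (fun m => (m, m)) G X.

(* G represents c times E: the pushout of E along multiplication by c on N. *)
Definition ext_scale (k : fieldType) (A : algType k) (M N : lmodType A)
    (c : k) (E G : extension M N) : Prop :=
  ext_morph (fun n => c%:A *: n) id E G.

(* dim_k Ext^1_A(M, N) = d: equivalence classes of extensions, with Baer sum
   and scalar multiplication, form a k-vector space isomorphic to k^d. *)
Definition dim_Ext1 (k : fieldType) (A : algType k) (M N : lmodType A)
    (d : nat) : Prop :=
  exists phi : extension M N -> 'rV[k]_d,
    [/\ forall E F, phi E = phi F <-> ext_equiv E F,
        forall x, exists E, phi E = x,
        forall E F G, baer_sum E F G -> phi G = phi E + phi F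
      & forall c E G, ext_scale c E G -> phi G = c *: phi E].

(* The Ext-quiver of A, with vertices labelled by the simple modules S i, has
   Q i j arrows from i to j. *)
Definition is_Ext_quiver (k : fieldType) (A : algType k) (n : nat)
    (S : 'I_n -> lmodType A) (Q : 'I_n -> 'I_n -> nat) : Prop :=
  complete_simples S /\ forall i j, dim_Ext1 (S i) (S j) (Q i j).


Definition pt1 : 'I_3 := @Ordinal 3 0 isT.
Definition pt2 : 'I_3 := @Ordinal 3 1 isT.
Definition pt3 : 'I_3 := @Ordinal 3 2 isT.

Definition is_transp (t : 'S_3) : bool :=
  [exists x, exists y, (x != y) && (t == tperm x y)].
Definition transp := {t : 'S_3 | is_transp t}.

Fact is_transp_tperm (x y : 'I_3) : x != y -> is_transp (tperm x y).
Proof. by move=> h; apply/existsP; exists x; apply/existsP; exists y; rewrite h /=. Qed.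

Definition t12 : transp := exist is_transp _ (@is_transp_tperm pt1 pt2 isT).
Definition t13 : transp := exist is_transp _ (@is_transp_tperm pt1 pt3 isT).
Definition t23 : transp := exist is_transp _ (@is_transp_tperm pt2 pt3 isT).

(* The product of 'S_n composes from left to right, so the composite "t after
   s" is (s * t)%g, and the composite "t i t^-1" is (i ^ t)%g; the sign of t
   is (-1) ^+ t. *)
Definition A1_relations (B : pzRingType) (H : 'S_3 -> B) (a : transp -> B) :=
  [/\ H 1%g = 1,
      forall t s, H t * H s = H (s * t)%g,
      forall t i j, val j = (val i ^ t)%g -> H t * a i = (-1) ^+ t * a j * H t,
      a t12 ^+ 2 = 0
    & a t12 * a t23 + a t23 * a t13 + a t13 * a t12
      = 1 - H (val t12) * H (val t23)].

Section A1.
Variable k : fieldType.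

(* A_1 is the quotient of the syntactic algebra expressions in the generators
   by the least congruence containing the k-algebra axioms and the defining
   relations. *)
Inductive A1_expr : Type :=
| EH of 'S_3
| Ea of transp
| EC of k
| EAdd of A1_expr & A1_expr
| EMul of A1_expr & A1_expr.

Inductive A1_eq : A1_expr -> A1_expr -> Prop :=
| Q_refl x : A1_eq x x
| Q_sym x y : A1_eq x y -> A1_eq y x
| Q_trans y x z : A1_eq x y -> A1_eq y z -> A1_eq x z
| Q_add x x' y y' : A1_eq x x' -> A1_eq y y' -> A1_eq (EAdd x y) (EAdd x' y')
| Q_mul x x' y y' : A1_eq x x' -> A1_eq y y' -> A1_eq (EMul x y) (EMul x' y')
| Q_addA x y z : A1_eq (EAdd x (EAdd y z)) (EAdd (EAdd x y) z)
| Q_addC x y : A1_eq (EAdd x y) (EAdd y x)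
| Q_add0 x : A1_eq (EAdd (EC 0) x) x
| Q_mul0 x : A1_eq (EMul (EC 0) x) (EC 0)
| Q_mulA x y z : A1_eq (EMul x (EMul y z)) (EMul (EMul x y) z)
| Q_mul1 x : A1_eq (EMul (EC 1) x) x
| Q_mulDl x y z : A1_eq (EMul (EAdd x y) z) (EAdd (EMul x z) (EMul y z))
| Q_mulDr x y z : A1_eq (EMul x (EAdd y z)) (EAdd (EMul x y) (EMul x z))
| Q_CD c d : A1_eq (EC (c + d)) (EAdd (EC c) (EC d))
| Q_CM c d : A1_eq (EC (c * d)) (EMul (EC c) (EC d))
| Q_CC c x : A1_eq (EMul (EC c) x) (EMul x (EC c))
| Q_H1 : A1_eq (EH 1%g) (EC 1)
| Q_HM t s : A1_eq (EMul (EH t) (EH s)) (EH (s * t)%g)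
| Q_Ha t i j : val j = (val i ^ t)%g ->
    A1_eq (EMul (EH t) (Ea i)) (EMul (EMul (EC ((-1) ^+ t)) (Ea j)) (EH t))
| Q_a2 : A1_eq (EMul (Ea t12) (Ea t12)) (EC 0)
| Q_aa :
    A1_eq (EAdd (EAdd (EMul (Ea t12) (Ea t23)) (EMul (Ea t23) (Ea t13)))
                (EMul (Ea t13) (Ea t12)))
          (EAdd (EC 1) (EMul (EC (-1)) (EMul (EH (val t12)) (EH (val t23))))).

HB.instance Definition _ := gen_eqMixin A1_expr.
HB.instance Definition _ := gen_choiceMixin A1_expr.

Definition A1_eqb (x y : A1_expr) : bool := `[< A1_eq x y >].

Fact A1_eqb_refl : reflexive A1_eqb.
Proof. by move=> x; apply/asboolP; apply: Q_refl. Qed.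
Fact A1_eqb_sym : symmetric A1_eqb.
Proof. by move=> x y; apply/asboolP/asboolP; apply: Q_sym. Qed.
Fact A1_eqb_trans : transitive A1_eqb.
Proof. by move=> y x z /asboolP xy /asboolP yz; apply/asboolP; apply: Q_trans yz. Qed.

Canonical A1_equiv := EquivRel A1_eqb A1_eqb_refl A1_eqb_sym A1_eqb_trans.

Definition A1 : Type := {eq_quot A1_eqb}%qT.

HB.instance Definition _ := Choice.on A1.

Definition A1_cls (x : A1_expr) : A1 := (\pi_({eq_quot A1_eqb}) x)%qT.
Definition A1_repr (x : A1) : A1_expr := generic_quotient.repr (x : {eq_quot A1_eqb}%qT).

Lemma A1_reprK x : A1_cls (A1_repr x) = x.
Proof. exact: reprK. Qed.

Lemma A1_clsP x y : A1_cls x = A1_cls y <-> A1_eq x y.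
Proof.
split=> [h|h]; last by apply/eqP; rewrite /A1_cls eqmodE; apply/asboolP.
by apply/asboolP; move/eqP: h; rewrite /A1_cls eqmodE.
Qed.

Lemma A1_repr_cls x : A1_eq (A1_repr (A1_cls x)) x.
Proof. by apply/A1_clsP; rewrite A1_reprK. Qed.

Lemma A1_ind (P : A1 -> Prop) : (forall x, P (A1_cls x)) -> forall x, P x.
Proof. by move=> h x; rewrite -(A1_reprK x). Qed.

Definition A1_add (x y : A1) : A1 := A1_cls (EAdd (A1_repr x) (A1_repr y)).
Definition A1_mul (x y : A1) : A1 := A1_cls (EMul (A1_repr x) (A1_repr y)).
Definition A1_const (c : k) : A1 := A1_cls (EC c).
Definition A1_opp (x : A1) : A1 := A1_mul (A1_const (-1)) x.
Definition A1_scale (c : k) (x : A1) : A1 := A1_mul (A1_const c) x.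

Lemma A1_addE x y : A1_add (A1_cls x) (A1_cls y) = A1_cls (EAdd x y).
Proof. by apply/A1_clsP; apply: Q_add; apply: A1_repr_cls. Qed.
Lemma A1_mulE x y : A1_mul (A1_cls x) (A1_cls y) = A1_cls (EMul x y).
Proof. by apply/A1_clsP; apply: Q_mul; apply: A1_repr_cls. Qed.

Fact A1_addA : associative A1_add.
Proof.
elim/A1_ind=> x; elim/A1_ind=> y; elim/A1_ind=> z; rewrite !A1_addE.
by apply/A1_clsP; constructor.
Qed.
Fact A1_addC : commutative A1_add.
Proof.
elim/A1_ind=> x; elim/A1_ind=> y; rewrite !A1_addE.
by apply/A1_clsP; apply: Q_addC.
Qed.
Fact A1_add0 : left_id (A1_const 0) A1_add.
Proof. by elim/A1_ind=> x; rewrite A1_addE; apply/A1_clsP; constructor. Qed.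
Fact A1_mulA : associative A1_mul.
Proof.
elim/A1_ind=> x; elim/A1_ind=> y; elim/A1_ind=> z; rewrite !A1_mulE.
by apply/A1_clsP; constructor.
Qed.
Fact A1_mul1 : left_id (A1_const 1) A1_mul.
Proof. by elim/A1_ind=> x; rewrite A1_mulE; apply/A1_clsP; constructor. Qed.
Fact A1_constC c x : A1_mul (A1_const c) x = A1_mul x (A1_const c).
Proof.
by elim/A1_ind: x => x; rewrite !A1_mulE; apply/A1_clsP; constructor.
Qed.
Fact A1_mulr1 : right_id (A1_const 1) A1_mul.
Proof. by move=> x; rewrite -A1_constC A1_mul1. Qed.
Fact A1_mulDl : left_distributive A1_mul A1_add.
Proof.
elim/A1_ind=> x; elim/A1_ind=> y; elim/A1_ind=> z.
by rewrite !(A1_addE, A1_mulE); apply/A1_clsP; constructor.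
Qed.
Fact A1_mulDr : right_distributive A1_mul A1_add.
Proof.
elim/A1_ind=> x; elim/A1_ind=> y; elim/A1_ind=> z.
by rewrite !(A1_addE, A1_mulE); apply/A1_clsP; constructor.
Qed.
Fact A1_constD c d : A1_const (c + d) = A1_add (A1_const c) (A1_const d).
Proof. by rewrite A1_addE; apply/A1_clsP; constructor. Qed.
Fact A1_constM c d : A1_const (c * d) = A1_mul (A1_const c) (A1_const d).
Proof. by rewrite A1_mulE; apply/A1_clsP; constructor. Qed.

Fact A1_addN : left_inverse (A1_const 0) A1_opp A1_add.
Proof.
elim/A1_ind=> x; rewrite /A1_opp -{2}[A1_cls x]A1_mul1 -A1_mulDl -A1_constD.
by rewrite addNr A1_mulE; apply/A1_clsP; constructor.
Qed.

HB.instance Definition _ :=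
  GRing.isZmodule.Build A1 A1_addA A1_addC A1_add0 A1_addN.

(* The module k with H_t acting by 1 and a_i by 0 separates 1 from 0. *)
Fixpoint A1_counit (x : A1_expr) : k :=
  match x with
  | EH _ => 1
  | Ea _ => 0
  | EC c => c
  | EAdd x y => A1_counit x + A1_counit y
  | EMul x y => A1_counit x * A1_counit y
  end.

Fact A1_counitP x y : A1_eq x y -> A1_counit x = A1_counit y.
Proof.
elim=> {x y} //=; rewrite ?(mul0r, mulr0, add0r, mulr1, addr0) //.
- by move=> x y z _ -> _ ->.
- by move=> x x' y y' _ -> _ ->.
- by move=> x x' y y' _ -> _ ->.
- by move=> *; rewrite addrA.
- by move=> *; rewrite addrC.
- by move=> *; rewrite add0r.
- by move=> *; rewrite mul0r.
- by move=> *; rewrite mulrA.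
- by move=> *; rewrite mul1r.
- by move=> *; rewrite mulrDl.
- by move=> *; rewrite mulrDr.
- by move=> *; rewrite mulrC.
- by move=> *; rewrite !mulr0 mul0r.
- by rewrite subrr.
Qed.

Fact A1_1neq0 : A1_const 1 != 0.
Proof.
apply/eqP=> /A1_clsP/A1_counitP/eqP /=; exact/negP/oner_neq0.
Qed.

HB.instance Definition _ := GRing.Zmodule_isNzRing.Build A1
  A1_mulA A1_mul1 A1_mulr1 A1_mulDl A1_mulDr A1_1neq0.

Fact A1_scaleA c d x : A1_scale c (A1_scale d x) = A1_scale (c * d) x.
Proof. by rewrite /A1_scale A1_constM A1_mulA. Qed.
Fact A1_scaleDl x : {morph A1_scale^~ x : c d / c + d}.
Proof. by move=> c d; rewrite /A1_scale A1_constD A1_mulDl. Qed.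

HB.instance Definition _ := GRing.Zmodule_isLmodule.Build k A1
  A1_scaleA A1_mul1 (fun c => A1_mulDr (A1_const c)) A1_scaleDl.

Fact A1_scaleAl c (x y : A1) : c *: (x * y) = (c *: x) * y.
Proof. exact: A1_mulA. Qed.
HB.instance Definition _ := GRing.Lmodule_isLalgebra.Build k A1 A1_scaleAl.

Fact A1_scaleAr c (x y : A1) : c *: (x * y) = x * (c *: y).
Proof.
rewrite -[LHS]/(A1_mul _ (A1_mul _ _)) -[RHS]/(A1_mul _ (A1_mul _ _)).
by rewrite !A1_mulA (A1_constC c x).
Qed.
HB.instance Definition _ := GRing.Lalgebra_isAlgebra.Build k A1 A1_scaleAr.

Definition A1_H (t : 'S_3) : A1 := A1_cls (EH t).
Definition A1_a (i : transp) : A1 := A1_cls (Ea i).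

Lemma A1_clsM x y : A1_cls (EMul x y) = A1_cls x * A1_cls y.
Proof. by rewrite -A1_mulE. Qed.
Lemma A1_clsD x y : A1_cls (EAdd x y) = A1_cls x + A1_cls y.
Proof. by rewrite -A1_addE. Qed.
Lemma A1_clsC c : A1_cls (EC c) = c%:A.
Proof. by rewrite -[LHS]A1_mulr1. Qed.

Lemma A1_relationsP : A1_relations A1_H A1_a.
Proof.
split; rewrite /A1_H /A1_a.
- by apply/A1_clsP; constructor.
- by move=> t s; rewrite -A1_clsM; apply/A1_clsP; constructor.
- move=> t i j e; have /A1_clsP := Q_Ha e.
  by rewrite !A1_clsM A1_clsC => ->; case: (odd_perm t); rewrite ?scaleN1r ?scale1r.
- by have /A1_clsP := Q_a2; rewrite A1_clsM A1_clsC scale0r expr2.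
- have /A1_clsP := Q_aa.
  by rewrite !A1_clsD !A1_clsM !A1_clsC => ->; rewrite scale1r scaleN1r mulN1r.
Qed.


Record A1_rep (n : nat) := A1Rep {
  rep_H : 'S_3 -> 'M[k]_n;
  rep_a : transp -> 'M[k]_n;
  rep_rel : A1_relations rep_H rep_a
}.

Definition rep_mod (n : nat) (r : A1_rep n) : Type := 'cV[k]_n.

Section RepModule.
Variables (n : nat) (r : A1_rep n).

Fixpoint rep_eval (x : A1_expr) : 'M[k]_n :=
  match x with
  | EH t => rep_H r t
  | Ea i => rep_a r i
  | EC c => c%:M
  | EAdd x y => rep_eval x + rep_eval y
  | EMul x y => rep_eval x *m rep_eval y
  end.

Fact rep_evalP x y : A1_eq x y -> rep_eval x = rep_eval y.
Proof.
have [H1 HM Ha a2 aa] := rep_rel r.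
elim=> {x y} //=.
- by move=> x y z _ -> _ ->.
- by move=> x x' y y' _ -> _ ->.
- by move=> x x' y y' _ -> _ ->.
- by move=> *; rewrite addrA.
- by move=> *; rewrite addrC.
- by move=> *; rewrite raddf0 add0r.
- by move=> *; rewrite raddf0 mul0mx.
- by move=> *; rewrite mulmxA.
- by move=> *; rewrite mul1mx.
- by move=> *; rewrite mulmxDl.
- by move=> *; rewrite mulmxDr.
- by move=> *; rewrite raddfD.
- by move=> *; rewrite scalar_mxM.
- by move=> *; rewrite scalar_mxC.
- move=> t i j e; rewrite [LHS](Ha _ _ _ e) -[LHS]/(_ *m _ *m _).
  by case: (odd_perm t); rewrite ?rmorphN ?rmorph1.
- by rewrite raddf0 -a2 expr2.
- by rewrite [LHS]aa raddfN mulNmx mul1mx.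
Qed.

HB.instance Definition _ := GRing.Zmodule.on (rep_mod r).

Definition rep_act (x : A1) (u : rep_mod r) : rep_mod r :=
  rep_eval (A1_repr x) *m u.

Lemma rep_actE x u : rep_act (A1_cls x) u = rep_eval x *m u.
Proof. by rewrite /rep_act (rep_evalP (A1_repr_cls x)). Qed.

Fact rep_actA x y u : rep_act x (rep_act y u) = rep_act (x * y) u.
Proof.
elim/A1_ind: x => x; elim/A1_ind: y => y.
by rewrite [_ * _]A1_mulE !rep_actE mulmxA.
Qed.
Fact rep_act1 : left_id 1 rep_act.
Proof. by move=> u; rewrite rep_actE mul1mx. Qed.
Fact rep_actDr : right_distributive rep_act +%R.
Proof. by move=> x u v; rewrite /rep_act mulmxDr. Qed.
Fact rep_actDl u : {morph rep_act^~ u : x y / x + y}.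
Proof.
elim/A1_ind=> x; elim/A1_ind=> y.
by rewrite [_ + _]A1_addE !rep_actE mulmxDl.
Qed.

HB.instance Definition _ := GRing.Zmodule_isLmodule.Build A1 (rep_mod r)
  rep_actA rep_act1 rep_actDr rep_actDl.

Lemma rep_modH t (u : rep_mod r) : A1_H t *: u = rep_H r t *m u.
Proof. exact: rep_actE. Qed.
Lemma rep_moda i (u : rep_mod r) : A1_a i *: u = rep_a r i *m u.
Proof. exact: rep_actE. Qed.
End RepModule.


Fact rep_triv_rel : @A1_relations 'M[k]_1 (fun=> 1) (fun=> 0).
Proof.
split=> //.
- by move=> *; rewrite mulr1.
- by move=> *; rewrite !(mulr0, mul0r).
- by rewrite expr0n.
- by rewrite !mulr0 !addr0 mulr1 subrr.
Qed.

Fact rep_sgn_rel : @A1_relations 'M[k]_1 (fun t => (-1) ^+ t) (fun=> 0).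
Proof.
split=> //.
- by rewrite odd_perm1.
- by move=> t s; rewrite odd_permM addbC signr_addb.
- by move=> *; rewrite !(mulr0, mul0r).
- by rewrite expr0n.
- by rewrite !mulr0 !addr0 !odd_tperm /= expr1 mulrNN mulr1 subrr.
Qed.

Definition S_eps : lmodType A1 := rep_mod (A1Rep rep_triv_rel).
Definition S_sgn : lmodType A1 := rep_mod (A1Rep rep_sgn_rel).


(* The matrix with rows (a, b) and (c, d). *)
Definition mx2 (a b c d : k) : 'M[k]_2 :=
  \matrix_(i, j) (if i == 0 then if j == 0 then a else b
                  else if j == 0 then c else d).

Lemma mx2P (M : 'M[k]_2) a b c d :
  M 0 0 = a -> M 0 1 = b -> M 1 0 = c -> M 1 1 = d -> M = mx2 a b c d.
Proof.
move=> <- <- <- <-; apply/matrixP => i j; rewrite mxE.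
case: i => -[|[|[|//]]] lt_i; case: j => -[|[|[|//]]] lt_j;
  by congr (M _ _); apply: val_inj.
Qed.

Lemma mx2M a b c d a' b' c' d' :
  mx2 a b c d * mx2 a' b' c' d' =
  mx2 (a * a' + b * c') (a * b' + b * d') (c * a' + d * c') (c * b' + d * d').
Proof. by apply: mx2P; rewrite mxE !big_ord_recl big_ord0 !mxE /= addr0. Qed.
Lemma mx2D a b c d a' b' c' d' :
  mx2 a b c d + mx2 a' b' c' d' = mx2 (a + a') (b + b') (c + c') (d + d').
Proof. by apply: mx2P; rewrite !mxE. Qed.
Lemma mx2N a b c d : - mx2 a b c d = mx2 (- a) (- b) (- c) (- d).
Proof. by apply: mx2P; rewrite !mxE. Qed.
Lemma mx2_1 : 1 = mx2 1 0 0 1.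
Proof. by apply: mx2P; rewrite !mxE. Qed.
Lemma mx2_0 : 0 = mx2 0 0 0 0.
Proof. by apply: mx2P; rewrite !mxE. Qed.

(* W_st in the basis v = e_1 - e_3, w = e_2 - e_3 of the vectors with zero
   coordinate sum in the permutation representation; column c of the matrix
   holds the coordinates of the image of the c-th basis vector.  *)
Definition st_H (t : 'S_3) : 'M[k]_2 :=
  let pt (c : 'I_2) : 'I_3 := widen_ord (isT : 2 <= 3)%N c in
  \matrix_(r, c) ((t (pt c) == pt r)%:R - (t pt3 == pt r)%:R).

Lemma st_H12 : st_H (val t12) = mx2 0 1 1 0.
Proof. by apply: mx2P; rewrite !mxE !permE /= ?(subr0, sub0r, subrr). Qed.
Lemma st_H23 : st_H (val t23) = mx2 1 0 (-1) (-1).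
Proof. by apply: mx2P; rewrite !mxE !permE /= ?(subr0, sub0r, subrr). Qed.
Lemma st_H13 : st_H (val t13) = mx2 (-1) (-1) 0 1.
Proof. by apply: mx2P; rewrite !mxE !permE /= ?(subr0, sub0r, subrr). Qed.
Lemma st_H1 : st_H 1%g = 1.
Proof.
by rewrite mx2_1; apply: mx2P; rewrite !mxE !perm1 /= ?(subr0, sub0r, subrr).
Qed.

Lemma st_HM t s : st_H t * st_H s = st_H (s * t)%g.
Proof.
apply/matrixP => i j; rewrite !mxE.
set pt := widen_ord _; pose f x : k := (t x == pt i)%:R - (t pt3 == pt i)%:R.
have fE x : \sum_(c < 2) f (pt c) * (x == pt c)%:R = f x.
  rewrite !big_ord_recl big_ord0 addr0; case: x => -[|[|[|//]]] lt_x.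
  - by rewrite mulr1 mulr0 addr0; congr f; apply/val_inj.
  - by rewrite mulr1 mulr0 add0r; congr f; apply/val_inj.
  - rewrite !mulr0 addr0 /f -[Ordinal _]/(Ordinal lt_x).
    have ->: Ordinal lt_x = pt3 by apply/val_inj.
    by rewrite subrr.
under eq_bigr => c _ do rewrite !mxE mulrBr.
rewrite sumrB !fE /f !permM; ring.
Qed.

(* The a_i determined by the action X of a_12: a_13 = - H_23 a_12 H_23 and
   a_23 = - H_13 a_12 H_13. *)
Definition st_a (X : 'M[k]_2) (i : transp) : 'M[k]_2 :=
  if i == t12 then X
  else if i == t13 then - (st_H (val t23) * X * st_H (val t23))
  else - (st_H (val t13) * X * st_H (val t13)).

Lemma transpP (i : transp) : [\/ i = t12, i = t13 | i = t23].
Proof.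
case: i => t i; have /existsP[x /existsP[y /andP[ne_xy /eqP e]]] := i.
suff: [\/ t = val t12, t = val t13 | t = val t23].
  by case=> h; [apply: Or31 | apply: Or32 | apply: Or33]; apply: val_inj.
have ptP (z : 'I_3) : [\/ z = pt1, z = pt2 | z = pt3].
  by case: z => -[|[|[|//]]] lt_z;
    [apply: Or31 | apply: Or32 | apply: Or33]; apply: val_inj.
rewrite {}e {i} in ne_xy *.
case: (ptP x) ne_xy => ->; case: (ptP y) => -> //= _;
  by [apply: Or31 | apply: Or32 | apply: Or33
     | apply: Or31; rewrite tpermC | apply: Or32; rewrite tpermC
     | apply: Or33; rewrite tpermC].
Qed.

Lemma t13_conj : val t13 = (val t12 * val t23 * val t12)%g.
Proof.
have := tpermJ pt2 pt3 (val t12); rewrite /= tpermR [tperm _ _ pt3]permE /=.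
by move=> <-; rewrite /conjg tpermV mulgA.
Qed.

Lemma S3_ind (P : 'S_3 -> Prop) :
  P 1%g -> P (val t12) -> P (val t23) ->
  (forall t s, P t -> P s -> P (t * s)%g) -> forall t, P t.
Proof.
move=> P1 P12 P23 PM t; have [ts -> dts] := prod_tpermP t.
elim: ts dts => [|[x y] ts IH] /=; first by rewrite big_nil.
case/andP=> ne_xy /IH Pts; rewrite big_cons /=; apply: (PM) => //.
have := transpP (exist is_transp _ (is_transp_tperm ne_xy)).
case=> /(congr1 val) /= -> //; rewrite -[tperm _ _]/(val t13) t13_conj.
by apply: (PM) => //; apply: (PM).
Qed.

Lemma t13_neq12 : (t13 == t12) = false.
Proof.
by apply/eqP => /(congr1 val)/permP/(_ pt1)/eqP; rewrite !permE.
Qed.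
Lemma t23_neq12 : (t23 == t12) = false.
Proof.
by apply/eqP => /(congr1 val)/permP/(_ pt1)/eqP; rewrite !permE.
Qed.
Lemma t23_neq13 : (t23 == t13) = false.
Proof.
by apply/eqP => /(congr1 val)/permP/(_ pt1)/eqP; rewrite !permE.
Qed.

Lemma is_transpJ (i : transp) (t : 'S_3) : is_transp (val i ^ t)%g.
Proof.
case: i => i /= /existsP[x /existsP[y /andP[ne_xy /eqP->]]].
by rewrite tpermJ is_transp_tperm // (inj_eq perm_inj).
Qed.

Lemma mx2_congr a b c d a' b' c' d' :
  a = a' -> b = b' -> c = c' -> d = d' -> mx2 a b c d = mx2 a' b' c' d'.
Proof. by move=> -> -> -> ->. Qed.

(* The general form of a matrix anticommuting with H_12. *)
Lemma st_rel p q :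
  p ^+ 2 = q ^+ 2 -> p ^+ 2 *+ 5 - p * q *+ 4 = -1 ->
  A1_relations st_H (st_a (mx2 p q (- q) (- p))).
Proof.
move=> pq e; set a := st_a _.
have a12 : a t12 = mx2 p q (- q) (- p) by rewrite /a /st_a eqxx.
have a13 : a t13 = mx2 (q - p) q (p *+ 2 - q *+ 2) (p - q).
  rewrite /a /st_a t13_neq12 eqxx st_H23 !mx2M mx2N; apply: mx2_congr; ring.
have a23 : a t23 = mx2 (q - p) (q *+ 2 - p *+ 2) (- q) (p - q).
  rewrite /a /st_a t23_neq12 t23_neq13 st_H13 !mx2M mx2N; apply: mx2_congr; ring.
split.
- exact: st_H1.
- exact: st_HM.
- elim/S3_ind => [i j|i j|i j|t s Pt Ps i j].
  + by rewrite conjg1 => /val_inj ->; rewrite odd_perm1 st_H1 !mulr1 mul1r.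
  + rewrite odd_tperm /= expr1 mulN1r st_H12.
    case: (transpP i) => -> /=; rewrite tpermJ !permE /= => hj.
    * have -> : j = t12 by apply: val_inj; rewrite -[RHS]tpermC; exact: hj.
      by rewrite a12 mx2N !mx2M; apply: mx2_congr; ring.
    * have -> : j = t23 by apply: val_inj; exact: hj.
      by rewrite a13 a23 mx2N !mx2M; apply: mx2_congr; ring.
    * have -> : j = t13 by apply: val_inj; exact: hj.
      by rewrite a13 a23 mx2N !mx2M; apply: mx2_congr; ring.
  + rewrite odd_tperm /= expr1 mulN1r st_H23.
    case: (transpP i) => -> /=; rewrite tpermJ !permE /= => hj.
    * have -> : j = t13 by apply: val_inj; exact: hj.
      by rewrite a12 a13 mx2N !mx2M; apply: mx2_congr; ring.
    * have -> : j = t12 by apply: val_inj; exact: hj.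
      by rewrite a13 a12 mx2N !mx2M; apply: mx2_congr; ring.
    * have -> : j = t23 by apply: val_inj; rewrite -[RHS]tpermC; exact: hj.
      by rewrite a23 mx2N !mx2M; apply: mx2_congr; ring.
  + rewrite conjgM => hj; pose i' : transp := exist is_transp _ (is_transpJ i t).
    have -> : st_H (t * s)%g = st_H s * st_H t by rewrite st_HM.
    rewrite -[LHS]mulrA (Pt i i' erefl) !mulrA (commr_sign (st_H s)).
    by rewrite -[_ * a i']mulrA (Ps i' j hj) !mulrA odd_permM signr_addb.
- rewrite a12 expr2 mx2M mx2_0; apply: mx2_congr; ring: pq.
- rewrite a12 a13 a23 st_H12 st_H23 mx2_1 !mx2M !mx2D mx2N mx2D.
  have e4 : p * q *+ 4 = p ^+ 2 *+ 5 + 1 by rewrite -[1]opprK -e; ring.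
  apply: mx2_congr; apply/eqP; rewrite -subr_eq0; apply/eqP.
  - transitivity (p * q *+ 4 *+ 2 - p ^+ 2 *+ 5 - q ^+ 2 *+ 5 - 2%:R); first ring.
    by rewrite e4 -pq; ring.
  - transitivity (p * q *+ 4 - p ^+ 2 *+ 4 - q ^+ 2 - 1); first ring.
    by rewrite e4 -pq; ring.
  - transitivity (p ^+ 2 *+ 4 + q ^+ 2 - p * q *+ 4 + 1); first ring.
    by rewrite e4 -pq; ring.
  - transitivity (p * q *+ 4 - q ^+ 2 *+ 4 - p ^+ 2 - 1); first ring.
    by rewrite e4 -pq; ring.
Qed.

Definition st_a12_i (theta : k) : 'M[k]_2 :=
  mx2 theta theta
      (- theta) (- theta).

Definition st_a12_i3 (theta : k) : 'M[k]_2 :=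
  mx2 theta (- theta)
      theta (- theta).

Fact S_st_i_rel theta :
  theta ^+ 2 = -1 -> A1_relations st_H (st_a (st_a12_i theta)).
Proof. by move=> e; apply: st_rel => //; rewrite -e; ring. Qed.

Fact S_st_i3_rel theta :
  (3%:R * theta) ^+ 2 = -1 -> A1_relations st_H (st_a (st_a12_i3 theta)).
Proof.
move=> e.
have -> : st_a12_i3 theta = mx2 theta (- theta) (- - theta) (- theta).
  by rewrite opprK.
apply: st_rel; first by rewrite sqrrN.
by rewrite -e; ring.
Qed.

(* S_st(theta) for theta = +-i, resp. theta = +-i/3. *)
Definition S_st_i theta (e : theta ^+ 2 = -1) : lmodType A1 :=
  rep_mod (A1Rep (S_st_i_rel e)).
Definition S_st_i3 theta (e : (3%:R * theta) ^+ 2 = -1) : lmodType A1 :=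
  rep_mod (A1Rep (S_st_i3_rel e)).

Section Simples.
Hypothesis char0 : [pchar k] =i pred0.
Variables (i : k) (i2 : i ^+ 2 = -1).

Fact sqr_opp_i : (- i) ^+ 2 = -1.
Proof. by rewrite sqrrN. Qed.
Fact sqr_i3 : (3%:R * (i / 3%:R)) ^+ 2 = -1.
Proof. by have /pcharf0P h := char0; rewrite mulrC divfK // h. Qed.
Fact sqr_opp_i3 : (3%:R * (- (i / 3%:R))) ^+ 2 = -1.
Proof. by rewrite mulrN sqrrN sqr_i3. Qed.

Definition A1_simples (j : 'I_6) : lmodType A1 :=
  match val j with
  | 0 => S_eps
  | 1 => S_sgn
  | 2 => S_st_i i2
  | 3 => S_st_i sqr_opp_i
  | 4 => S_st_i3 sqr_i3
  | _ => S_st_i3 sqr_opp_i3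
  end%N.
End Simples.

End A1.

(* Main.v *)
(* Write h = H_12, x = a_12, d = H_23 - H_13, and let E = 1 + rho + rho^2 with
   rho a 3-cycle, so that E^2 = 3 E, E d = d E = 0 and d^2 = 3 - E.  Conjugation
   by h splits the quadratic relation of A_1 into an even and an odd part; these
   give E x E x E = E x d x E = 0 and show that E x and E x d x d x anticommute
   and square to zero on the image of E.  A common kernel vector u either has
   x u = 0, and then spans a one-dimensional module, or produces v = d x u with
   (d x)^2 v = -4 v, x d v = 0, and an eigenvector of d x then spans a copy of
   some S_st(theta).  Thus every nonzero module, of any dimension, contains one
   of the six.
   By Maschke's theorem an extension of M by N splits over S_3, so it amounts to
   the off-diagonal block Z of a_12.  The relations are linear conditions on Z,
   and Z matters only up to a_N Y - Y a_M with Y an S_3-equivariant map. *)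
From HB Require Import structures.
From Stdlib Require Import Ncring Ncring_tac.
Require Import Defs.
From mathcomp Require Import all_boot all_order all_algebra all_fingroup.
From mathcomp Require Import ring.
From mathcomp Require Import boolp.

Set Implicit Arguments.
Unset Strict Implicit.
Unset Printing Implicit Defensive.

Import GRing.Theory.
Local Open Scope ring_scope.

(** * Identities in A_1 *)

(** [A1] is known only by generators and relations, and no basis of it is ever computed;
    completeness of the list must come from identities valid in every module. They are proved over
    rings assumed at most free of 2- and 3-torsion, the long ones by explicit combinations of
    relators. Four standard modules arise because an eigenvector of d x carries two signs: that of
    h, and that of the eigenvalue 2i or -2i. The sign 1 of h leads to theta = +-i, the sign -1 to
    theta = +-i/3. Write (p, q) for (theta, theta), resp. (theta, -theta). Between a character of
    sign eta and a standard module, anticommutation with h leaves one free entry in Z, and the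
    relation x^2 = 0 kills it unless p = eta q (character to standard) or p = - eta q (standard to
    character). This test yields the eight arrows between characters and standard modules. Between
    standard modules nothing survives, because the equations satisfied by (p, q) have only simple
    solutions. *)

Section NcRing.
Variable B : pzRingType.

(** [A1] is not commutative; these instances hand a [pzRingType] to the tactic
    [non_commutative_ring]. *)
#[export] Instance pzRing_ops :
  @Ring_ops B 0 1 (@GRing.add B) (@GRing.mul B) (fun x y => x - y)
    (@GRing.opp B) (@eq B) := {}.

#[export] Instance pzRing_ncring :
  @Ring B 0 1 (@GRing.add B) (@GRing.mul B) (fun x y => x - y)
    (@GRing.opp B) (@eq B) pzRing_ops.
Proof.
constructor; try exact _; try (by move=> ? ? -> ? ? ->); try (by move=> ? ? ->).
- exact: add0r.
- exact: addrC.
- exact: addrA.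
- exact: mul1r.
- exact: mulr1.
- exact: mulrA.
- by move=> *; exact: mulrDl.
- by move=> *; exact: mulrDr.
- by [].
- exact: subrr.
Qed.
End NcRing.

Ltac ncring := rewrite ?expr2 ?mulr2n ?mulrS ?mulr0n ?addr0; non_commutative_ring.


Lemma mulrA_sym (B : pzRingType) (a b c : B) : a * b * c = a * (b * c).
Proof. by rewrite mulrA. Qed.

(** * The group algebra of S_3 in terms of E and d *)

Section S3Identities.
Variables (B : pzRingType) (h g : B).
Hypotheses (hh : h * h = 1) (gg : g * g = 1) (ghg : g * h * g = h * g * h).
Let t := h * g * h.
Let E := 1 + h * g + g * h.
Let d := g - t.

Let hK y : h * (h * y) = y. Proof. by rewrite mulrA hh mul1r. Qed.
Let gK y : g * (g * y) = y. Proof. by rewrite mulrA gg mul1r. Qed.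
Let ghg' : g * (h * g) = h * (g * h). Proof. by rewrite !mulrA. Qed.
Let ghgK y : g * (h * (g * y)) = h * (g * (h * y)).
Proof. by rewrite !mulrA ghg. Qed.
(** Rewriting right-nested words with these rules leaves only 1, h, g, hg, gh, hgh, one for each
    element of S_3. *)
Let grp := (hh, gg, hK, gK, ghg', ghgK).
Let expand := (@mulrDl B, @mulrDr B, @mulNr B, @mulrN B, @mulr1 B, @mul1r B,
  @mulrA_sym B).

Lemma S3_EE : E * E = E + E + E.
Proof. by rewrite /E !(expand, grp); ncring. Qed.
Lemma S3_Ed : E * d = 0.
Proof. by rewrite /E /d /t !(expand, grp); ncring. Qed.
Lemma S3_dE : d * E = 0.
Proof. by rewrite /E /d /t !(expand, grp); ncring. Qed.
Lemma S3_dd : d * d = 1 + 1 + 1 - E.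
Proof. by rewrite /E /d /t !(expand, grp); ncring. Qed.
Lemma S3_dh : d * h = - (h * d).
Proof. by rewrite /d /t !(expand, grp); ncring. Qed.
Lemma S3_Eh : E * h = h * E.
Proof. by rewrite /E !(expand, grp); ncring. Qed.
(** Since g + t = h (hg + gh) = h (E - 1) and d = g - t. Conjugation by g or t can thus be expanded
    in h, E and d. *)
Lemma S3_gE : g + g = h * (E - 1) + d.
Proof. by rewrite /E /d /t !(expand, grp); ncring. Qed.
Lemma S3_tE : t + t = h * (E - 1) - d.
Proof. by rewrite /E /d /t !(expand, grp); ncring. Qed.
End S3Identities.

(** * Conjugates of [x], split by their behaviour under [h] *)

Section Conjugation.
Variables (B : pzRingType) (h g t S d x : B).
Hypotheses (Sh : S * h = h * S) (dh : d * h = - (h * d)).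
Hypotheses (xh : x * h = - (h * x)) (hh : h * h = 1).
Hypotheses (gE : g + g = h * S + d) (tE : t + t = h * S - d).
Let M := S * x * S - d * x * d.
Let N := S * x * d + d * x * S.

Let Sh0 : S * h - h * S = 0. Proof. by rewrite Sh subrr. Qed.
Let dh0 : d * h + h * d = 0. Proof. by rewrite dh addNr. Qed.
Let xh0 : x * h + h * x = 0. Proof. by rewrite xh addNr. Qed.
Let h0 := (Sh0, dh0, xh0, @mulr0 B, @mul0r B, @addr0 B, @subr0 B, @oppr0 B).

(** [S] commutes with [h], while [d] and [x] anticommute: moving [h] across a word costs one sign
    per [d] or [x]. The displayed sum is a certificate, a combination of the relators [Sh0], [dh0],
    [xh0]; later long [transitivity] steps are of the same kind. *)
Lemma even_anticomm : M * h = - (h * M).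
Proof.
apply/eqP; rewrite -subr_eq0 opprK; apply/eqP.
transitivity (S * x * (S * h - h * S) + S * (x * h + h * x) * S
  - (S * h - h * S) * x * S - (d * x * (d * h + h * d)
  - d * (x * h + h * x) * d + (d * h + h * d) * x * d)).
  by rewrite /M; ncring.
by rewrite !h0.
Qed.

Lemma odd_comm : N * h = h * N.
Proof.
apply/eqP; rewrite -subr_eq0; apply/eqP.
transitivity (S * x * (d * h + h * d) - S * (x * h + h * x) * d
  + (S * h - h * S) * x * d
  + d * x * (S * h - h * S) + d * (x * h + h * x) * S - (d * h + h * d) * x * S).
  by rewrite /N; ncring.
by rewrite !h0.
Qed.

Let hh0 : h * h - 1 = 0. Proof. by rewrite hh subrr. Qed.

(** With S = E - 1 this computes 4 a_13, and the next lemma 4 a_23; the factor 4 avoids halving [gE]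
    and [tE]. *)
Lemma quadruple_conj_g : (1 + 1 + 1 + 1) * - (g * x * g) = M - h * N.
Proof.
transitivity (- ((g + g) * x * (g + g))); first by ncring.
rewrite gE; apply/eqP; rewrite -subr_eq0; apply/eqP.
transitivity (- (h * S * (x * h + h * x) * S - h * (S * h - h * S) * x * S
  - (h * h - 1) * S * x * S + d * (x * h + h * x) * S
  - (d * h + h * d) * x * S)); first by rewrite /M /N; ncring.
by rewrite hh0 !h0.
Qed.

Lemma quadruple_conj_t : (1 + 1 + 1 + 1) * - (t * x * t) = M + h * N.
Proof.
transitivity (- ((t + t) * x * (t + t))); first by ncring.
rewrite tE; apply/eqP; rewrite -subr_eq0; apply/eqP.
transitivity (- (h * S * (x * h + h * x) * S - h * (S * h - h * S) * x * S
  - (h * h - 1) * S * x * S - d * (x * h + h * x) * S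
  + (d * h + h * d) * x * S)); first by rewrite /M /N; ncring.
by rewrite hh0 !h0.
Qed.

End Conjugation.

(** * Even and odd parts of the quadratic relation *)

Section Parity.
Variables (B : pzRingType) (h g S d x a b M N : B).
Hypothesis tf2 : forall y : B, y + y = 0 -> y = 0.
Hypotheses (hh : h * h = 1) (Sh : S * h = h * S) (dh : d * h = - (h * d)).
Hypotheses (gE : g + g = h * S + d) (xh : x * h = - (h * x)).
Hypotheses (Mh : M * h = - (h * M)) (Nh : N * h = h * N).
Let n2 : B := 1 + 1.
Let n4 : B := 1 + 1 + 1 + 1.
Hypotheses (aE : n4 * a = M - h * N) (bE : n4 * b = M + h * N).
Hypotheses (aa : a * a = 0) (bb : b * b = 0).
Hypothesis rel : x * b + b * a + a * x = 1 - h * g.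

Let hK y : h * (h * y) = y. Proof. by rewrite mulrA hh mul1r. Qed.
Let aa16 : (M - h * N) * (M - h * N) = 0.
Proof.
by rewrite -aE; transitivity (n4 * n4 * (a * a));
  [rewrite /n4; ncring | rewrite aa mulr0].
Qed.
Let bb16 : (M + h * N) * (M + h * N) = 0.
Proof.
by rewrite -bE; transitivity (n4 * n4 * (b * b));
  [rewrite /n4; ncring | rewrite bb mulr0].
Qed.

Let hNhN : h * N * (h * N) = N * N.
Proof. by rewrite -{1}Nh -mulrA (mulrA h) hh mul1r. Qed.

(** Sum and difference of (M + h N)^2 = 0 and (M - h N)^2 = 0 give this identity and the next. *)
Let MM_NN : M * M + N * N = 0.
Proof.
apply: tf2; rewrite -hNhN; transitivity ((M - h * N) * (M - h * N)
  + (M + h * N) * (M + h * N)); first by ncring.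
by rewrite aa16 bb16 addr0.
Qed.

Let hMN : h * N * M + M * (h * N) = 0.
Proof.
apply: tf2; transitivity ((M + h * N) * (M + h * N)
  - (M - h * N) * (M - h * N)); first by ncring.
by rewrite aa16 bb16 subr0.
Qed.

Let P := n2 * (x * M + M * x) + M * M - n4 * n2 + n4 * S.
Let Q := N * M + n4 * d - n2 * (x * N + N * x).

(** Sixteen times the quadratic relation is 2 (P + h Q), once N N is replaced by - M M and M h N by
    - h N M. *)
Let PQ0 : P + h * Q = 0.
Proof.
apply: tf2.
transitivity (n4 * n4 * (x * b + b * a + a * x - (1 - h * g))); last first.
  by rewrite rel subrr mulr0.
transitivity (n4 * x * (n4 * b) + (n4 * b) * (n4 * a) + (n4 * a) * n4 * x
   - (n4 * n4 - n4 * n2 * (h * (g + g)))); last by rewrite /n4 /n2; ncring.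
rewrite aE bE gE; apply/eqP; rewrite -subr_eq0; apply/eqP.
transitivity ((M * M + N * N) + (h * N * M + M * (h * N))
  + (h * N * (h * N) - N * N)
  - n4 * (x * h + h * x) * N - n4 * n2 * (h * h - 1) * S).
  by rewrite /P /Q /n4 /n2; ncring.
by rewrite MM_NN hMN hNhN xh hh addNr !subrr !(mulr0, mul0r, addr0, subr0).
Qed.

Let Ph : P * h = h * P.
Proof.
apply/eqP; rewrite -subr_eq0; apply/eqP.
transitivity (n2 * (x * (M * h + h * M) - (x * h + h * x) * M
    + M * (x * h + h * x) - (M * h + h * M) * x)
  + M * (M * h + h * M) - (M * h + h * M) * M + n4 * (S * h - h * S)).
  by rewrite /P /n4 /n2; ncring.
by rewrite xh Mh Sh !addNr subrr !(mulr0, mul0r, addr0, subr0).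
Qed.

Let Qh : Q * h = - (h * Q).
Proof.
apply/eqP; rewrite -subr_eq0 opprK; apply/eqP.
transitivity (N * (M * h + h * M) - (N * h - h * N) * M + n4 * (d * h + h * d)
  - n2 * (x * (N * h - h * N) + (x * h + h * x) * N + N * (x * h + h * x)
          - (N * h - h * N) * x)).
  by rewrite /Q /n4 /n2; ncring.
by rewrite xh Mh Nh dh !addNr subrr !(mulr0, mul0r, addr0, subr0).
Qed.

(** Conjugation by [h] fixes P and negates h Q. *)
Let PQ1 : P - h * Q = 0.
Proof.
transitivity (h * (P + h * Q) * h); last by rewrite PQ0 mulr0 mul0r.
by rewrite (mulrDr h P) hK (mulrDl (h * P)) Qh -mulrA Ph hK.
Qed.

Lemma even_relation : n2 * (x * M + M * x) + M * M - n4 * n2 + n4 * S = 0.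
Proof.
rewrite -/P; apply: tf2; transitivity ((P + h * Q) + (P - h * Q)).
  by ncring.
by rewrite PQ0 PQ1 addr0.
Qed.

Lemma odd_relation : N * M + n4 * d - n2 * (x * N + N * x) = 0.
Proof.
have hQ0 : h * Q = 0 by move: PQ0; rewrite {1}/P even_relation add0r.
by rewrite -/Q -[Q]hK hQ0 mulr0.
Qed.

End Parity.

(** * Words in [x], [E] and [d] modulo the two relations *)

Section Nilpotency.
Variables (B : pzRingType) (E d x : B).
Hypothesis tf2 : forall y : B, y + y = 0 -> y = 0.
Hypothesis tf3 : forall y : B, y + y + y = 0 -> y = 0.
Hypotheses (EE : E * E = E + E + E) (Ed : E * d = 0) (dE : d * E = 0).
Hypotheses (dd : d * d = 1 + 1 + 1 - E) (xx : x * x = 0).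
Let n2 : B := 1 + 1.
Let n4 : B := 1 + 1 + 1 + 1.
Let expand := (@mulrDl B, @mulrDr B, @mulNr B, @mulrN B, @mulr1 B, @mul1r B,
  @mulrA_sym B).
Let even_part := n2 * (x * ((E - 1) * x * (E - 1) - d * x * d)
  + ((E - 1) * x * (E - 1) - d * x * d) * x)
  + ((E - 1) * x * (E - 1) - d * x * d) * ((E - 1) * x * (E - 1) - d * x * d)
  - n4 * n2 + n4 * (E - 1).
Let odd_part := ((E - 1) * x * d + d * x * (E - 1))
    * ((E - 1) * x * (E - 1) - d * x * d) + n4 * d
  - n2 * (x * ((E - 1) * x * d + d * x * (E - 1))
          + ((E - 1) * x * d + d * x * (E - 1)) * x).
Hypotheses (even0 : even_part = 0) (odd0 : odd_part = 0).

Let xK y : x * (x * y) = 0. Proof. by rewrite mulrA xx mul0r. Qed.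
Let EEK y : E * (E * y) = E * y + E * y + E * y.
Proof. by rewrite mulrA EE !mulrDl. Qed.
Let EdK y : E * (d * y) = 0. Proof. by rewrite mulrA Ed mul0r. Qed.
Let dEK y : d * (E * y) = 0. Proof. by rewrite mulrA dE mul0r. Qed.
Let ddK y : d * (d * y) = y + y + y - E * y.
Proof. by rewrite mulrA dd !mulrDl !mul1r mulNr. Qed.
(** These rules reduce every word to alternating ones, where the letters [x] are separated by a
    single [E] or [d]. *)
Let red := (xx, xK, EE, EEK, Ed, EdK, dE, dEK, dd, ddK, @mulr0 B, @mul0r B).

(** Multiplying the even relation by E on both sides kills the words with d next to an outer E,
    cancels the constants (24 E against 24 E) and leaves 12 E x E x E. *)
Lemma ExExE : E * x * E * x * E = 0.
Proof.
apply: tf2; apply: tf2; apply: tf3.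
have <- : E * even_part * E = 0 by rewrite even0 mulr0 mul0r.
by rewrite /even_part /n4 /n2 !(expand, red); ncring.
Qed.

Lemma ExdxE : E * x * d * x * E = 0.
Proof.
apply: tf2; apply: tf2; apply: tf3.
have <- : E * - odd_part * E = 0 by rewrite odd0 oppr0 mulr0 mul0r.
by rewrite /odd_part /n4 /n2 !(expand, red); ncring.
Qed.

Let EExE : E * (x * (E * (x * E))) = 0.
Proof. by rewrite !mulrA ExExE. Qed.
Let EdxE : E * (x * (d * (x * E))) = 0.
Proof. by rewrite !mulrA ExdxE. Qed.

(** Up to a term ending in E x E, this says (d x)^2 = -4 on the image of d x E: the origin of the
    eigenvalues +-2i. *)
Lemma dxdxdxE : d * x * d * x * d * x * E * (1 + 1 + 1)
  = d * d * x * d * x * E * x * E - d * x * E * (n4 + n4 + n4).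
Proof.
apply/eqP; rewrite -subr_eq0; apply/eqP; apply: tf3.
have <- : d * d * - even_part * d * x * E = 0.
  by rewrite even0 oppr0 mulr0 !mul0r.
by rewrite /even_part /n4 /n2 !(expand, red, EExE, EdxE); ncring.
Qed.

(** From d d = 3 - E and x x = 0. It trades an inner E for two d, which makes [dxdxdxE]
    applicable. *)
Lemma xEx : x * E * x = - (x * d * d * x).
Proof. by rewrite !(expand, red); ncring. Qed.

Lemma ExExdxdxE : E * x * E * x * d * x * d * x * E
  = - (E * x * d * x * d * x * E * x * E).
Proof.
apply/eqP; rewrite -subr_eq0 opprK; apply/eqP; apply: tf3.
transitivity (E * x * d * x * d * x * E * x * E * (1 + 1 + 1)
  + E * (x * E * x) * d * x * d * x * E * (1 + 1 + 1)); first by ncring.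
rewrite xEx.
transitivity (E * x * d * x * d * x * E * x * E * (1 + 1 + 1)
  - E * x * d * (d * x * d * x * d * x * E * (1 + 1 + 1))); first by ncring.
by rewrite dxdxdxE /n4 !(expand, red, EExE, EdxE); ncring.
Qed.

Lemma square_ExdxdxE :
  E * x * d * x * d * x * E * x * d * x * d * x * E = 0.
Proof.
apply: tf3.
transitivity (E * x * d * x * d * (x * E * x) * d * x * d * x * E * (1 + 1 + 1)).
  by ncring.
rewrite xEx.
transitivity (- (E * x * d * x * d * x * d * (d * x * d * x * d * x * E * (1 + 1 + 1)))).
  by ncring.
rewrite dxdxdxE; pose r := n4 + n4 + n4; rewrite -/r.
transitivity (E * x * d * x * d * (x * d * d * x) * E * r
  - E * x * d * x * d * x * (d * (d * d)) * x * d * x * E * x * E).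
  by rewrite /r /n4; ncring.
have -> : d * (d * d) = d * (1 + 1 + 1) by rewrite !(expand, red); ncring.
(* Going back from d d to E makes this term cancel against one produced by the second use of
   [dxdxdxE]. *)
rewrite -[_ * d * d * x]opprK -xEx.
transitivity (- (E * x * d * x * d * x * E * x * E * r)
  - E * x * d * x * (d * x * d * x * d * x * E * (1 + 1 + 1)) * x * E).
  by rewrite /r /n4; ncring.
rewrite dxdxdxE -/r.
transitivity (- (E * x * d * x * d * d * x * d * x * (E * x * E * x * E))).
  by rewrite /r /n4; ncring.
by rewrite ExExE mulr0 oppr0.
Qed.

(** The even relation with all terms containing E gathered on the right, for use on modules where E
    acts as 0. *)
Lemma dxdx_xdxd : (d * x * d * x + x * d * x * d) * (1 + 1 + 1) + n4 * (1 + 1 + 1)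
  = n2 * (x * E * x * (E - 1) + (E - 1) * x * E * x)
    + (E - 1) * x * E * x * (E - 1) - d * x * E * x * d
    + E * x * d * x * d + d * x * d * x * E + n4 * E.
Proof.
apply/eqP; rewrite -subr_eq0; apply/eqP.
have <- : - even_part = 0 by rewrite even0 oppr0.
by rewrite /even_part /n4 /n2 !(expand, red); ncring.
Qed.

End Nilpotency.

(** * Generators and distinguished vectors *)

Lemma t13_conj23 : val t13 = (val t23 * val t12 * val t23)%g.
Proof.
have := tpermJ pt1 pt2 (val t23); rewrite /= tpermL [tperm _ _ pt1]permE /=.
by move=> <-; rewrite /conjg tpermV mulgA.
Qed.

Section Presentation.
Variables (B : pzRingType) (H : 'S_3 -> B) (a : transp -> B).

Lemma A1_relations_conj : A1_relations H a ->
  [/\ H (val t12) * a t12 = - (a t12 * H (val t12)),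
      a t13 = - (H (val t23) * a t12 * H (val t23)) &
      a t23 = - (H (val t13) * a t12 * H (val t13))].
Proof.
move=> [H1 HM Ha _ _].
have Hs y z : y != z -> H (tperm y z) * H (tperm y z) = 1 by rewrite HM tperm2 H1.
split.
- rewrite (Ha _ t12 t12) ?odd_tperm /= ?expr1 ?mulN1r ?mulNr //.
  by rewrite /= tpermJ tpermL tpermR tpermC.
- rewrite (Ha _ t12 t13) ?odd_tperm /= ?expr1 ?mulN1r ?mulNr ?opprK //.
    by rewrite -mulrA Hs // mulr1.
  by rewrite /= tpermJ !permE.
- rewrite (Ha _ t12 t23) ?odd_tperm /= ?expr1 ?mulN1r ?mulNr ?opprK //.
    by rewrite -mulrA Hs // mulr1.
  by rewrite /= tpermJ !permE /= tpermC.
Qed.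

(** One instance of the relation between H_t and a_i suffices: a_13 and a_23 are given as conjugates
    of a_12, and (12) and (23) generate S_3. *)
Lemma A1_relations_intro :
  H 1%g = 1 -> (forall t s, H t * H s = H (s * t)%g) ->
  H (val t12) * a t12 = - (a t12 * H (val t12)) ->
  a t13 = - (H (val t23) * a t12 * H (val t23)) ->
  a t23 = - (H (val t13) * a t12 * H (val t13)) ->
  a t12 * a t12 = 0 ->
  a t12 * a t23 + a t23 * a t13 + a t13 * a t12 = 1 - H (val t12) * H (val t23) ->
  A1_relations H a.
Proof.
move=> H1 HM hx a13 a23 xx aa; split=> //.
pose h := H (val t12); pose g := H (val t23); pose x := a t12.
have hh : h * h = 1 by rewrite HM tperm2 H1.
have gg : g * g = 1 by rewrite HM tperm2 H1.
have tE : H (val t13) = h * g * h by rewrite !HM t13_conj mulgA.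
have tE' : H (val t13) = g * h * g by rewrite !HM t13_conj23 mulgA.
have xh : x * h = - (h * x) by rewrite hx opprK.
have xhK y : x * (h * y) = - (h * (x * y)) by rewrite mulrA xh mulNr mulrA.
have hK y : h * (h * y) = y by rewrite mulrA hh mul1r.
have gK y : g * (g * y) = y by rewrite mulrA gg mul1r.
rewrite -/h -/g -/x in a13 a23 *.
elim/S3_ind => [i j|i j|i j|t s Pt Ps i j].
- by rewrite conjg1 => /val_inj ->; rewrite odd_perm1 H1 !mulr1 mul1r.
- rewrite odd_tperm /= expr1 mulN1r -/h.
  case: (transpP i) => -> /=; rewrite tpermJ !permE /= => hj.
  + have -> : j = t12 by apply: val_inj; rewrite -[RHS]tpermC; exact: hj.
    by rewrite hx mulNr.
  + have -> : j = t23 by apply: val_inj; exact: hj.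
    by rewrite a13 a23 tE opprK -!mulrA hh mulr1 xhK !mulrN hK.
  + have -> : j = t13 by apply: val_inj; exact: hj.
    by rewrite a13 a23 tE opprK mulrN -!mulrA hK xhK !mulrN hK opprK.
- rewrite odd_tperm /= expr1 mulN1r -/g.
  case: (transpP i) => -> /=; rewrite tpermJ !permE /= => hj.
  + have -> : j = t13 by apply: val_inj; exact: hj.
    by rewrite a13 opprK -!mulrA gg mulr1.
  + have -> : j = t12 by apply: val_inj; exact: hj.
    by rewrite a13 mulrN -!mulrA gK mulNr.
  + have -> : j = t23 by apply: val_inj; rewrite -[RHS]tpermC; exact: hj.
    (* The two words for H_13 are placed so that both sides become [h * g * h * x * g * h]. *)
    rewrite a23 opprK mulrN {1}tE' {2}tE {1}tE -!mulrA gK xhK !mulrN opprK.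
    have -> : H (val t13) * g = g * h by rewrite tE' -!mulrA gg mulr1.
    by [].
- rewrite conjgM => hj; pose i' : transp := exist is_transp _ (is_transpJ i t).
  have -> : H (t * s)%g = H s * H t by rewrite HM.
  rewrite -[LHS]mulrA (Pt i i' erefl) !mulrA (commr_sign (H s)).
  by rewrite -[_ * a i']mulrA (Ps i' j hj) !mulrA odd_permM signr_addb.
Qed.
End Presentation.

Lemma linear_of (R : pzRingType) (V W : lmodType R) (f : V -> W) :
  linear f -> exists F : {linear V -> W}, F =1 f.
Proof.
move=> lf; pose L := GRing.isLinear.Build R V W *:%R f lf.
by pose F : {linear V -> W} := HB.pack f L; exists F.
Qed.

Section Generators.
Variable k : fieldType.
Local Notation A := (A1 k).
Local Notation h := (A1_H k (val t12)).
Local Notation g := (A1_H k (val t23)).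
Local Notation t := (A1_H k (val t13)).
Local Notation x := (A1_a k t12).

Lemma A1_HM (s r : 'S_3) : A1_H k s * A1_H k r = A1_H k (r * s)%g.
Proof. by have [_ HM _ _ _] := A1_relationsP k; exact: HM. Qed.

Lemma A1_H1 : A1_H k 1%g = 1.
Proof. by have [] := A1_relationsP k. Qed.

Lemma A1_hh : h * h = 1. Proof. by rewrite A1_HM tperm2 A1_H1. Qed.
Lemma A1_gg : g * g = 1. Proof. by rewrite A1_HM tperm2 A1_H1. Qed.
Lemma A1_tt : t * t = 1. Proof. by rewrite A1_HM tperm2 A1_H1. Qed.

Lemma A1_hgh : h * g * h = t.
Proof. by rewrite !A1_HM t13_conj mulgA. Qed.

Lemma A1_ghg : g * h * g = h * g * h.
Proof. by rewrite A1_hgh !A1_HM t13_conj23 mulgA. Qed.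

Lemma A1_xh : x * h = - (h * x).
Proof. by have [-> _ _] := A1_relations_conj (A1_relationsP k); rewrite opprK. Qed.

Lemma A1_a13 : A1_a k t13 = - (g * x * g).
Proof. by have [] := A1_relations_conj (A1_relationsP k). Qed.

Lemma A1_a23 : A1_a k t23 = - (t * x * t).
Proof. by have [] := A1_relations_conj (A1_relationsP k). Qed.

Lemma A1_xx : x * x = 0.
Proof. by have [_ _ _ + _] := A1_relationsP k; rewrite expr2. Qed.

Lemma A1_quad : x * A1_a k t23 + A1_a k t23 * A1_a k t13 + A1_a k t13 * x
  = 1 - h * g.
Proof. by have [] := A1_relationsP k. Qed.

Section GeneratorInduction.
Variables V W : lmodType A.

(* A_1 is generated by the scalars, H_12, H_23 and a_12. *)
Lemma A1_semilinear (f : V -> W) :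
  (forall u v, f (u + v) = f u + f v) ->
  (forall c u, f (c%:A *: u) = c%:A *: f u) ->
  (forall u, f (h *: u) = h *: f u) -> (forall u, f (g *: u) = g *: f u) ->
  (forall u, f (x *: u) = x *: f u) ->
  forall (b : A) u, f (b *: u) = b *: f u.
Proof.
move=> fD fC fh fg fx.
have fM (a b : A) : (forall u, f (a *: u) = a *: f u) ->
    (forall u, f (b *: u) = b *: f u) ->
    forall u, f ((a * b) *: u) = (a * b) *: f u.
  by move=> fa fb u; rewrite -!scalerA fa fb.
have fN (a : A) : (forall u, f (a *: u) = a *: f u) ->
    forall u, f (- a *: u) = - a *: f u.
  move=> fa u; rewrite -[a]scale1r -scaleNr -mulr_algl.
  by apply: fM.
have fH : forall s u, f (A1_H k s *: u) = A1_H k s *: f u.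
  elim/S3_ind => //; first by rewrite A1_H1 => u; rewrite !scale1r.
  by move=> s r fs fr; rewrite -A1_HM; apply: fM.
elim/A1_ind; elim=> [s|j|c|y IHy z IHz|y IHy z IHz] u.
- exact: fH.
- case: (transpP j) => ->; first exact: fx.
    rewrite -[A1_cls _]/(A1_a k t13) A1_a13.
    by apply: (fN); apply: (fM) => //; apply: (fM).
  rewrite -[A1_cls _]/(A1_a k t23) A1_a23.
  by apply: (fN); apply: (fM) => //; apply: (fM).
- by rewrite A1_clsC fC.
- by rewrite A1_clsD !scalerDl fD IHy IHz.
- by rewrite A1_clsM; apply: fM.
Qed.

Lemma A1_linear_of (f : V -> W) :
  (forall u v, f (u + v) = f u + f v) ->
  (forall c u, f (c%:A *: u) = c%:A *: f u) ->
  (forall u, f (h *: u) = h *: f u) -> (forall u, f (g *: u) = g *: f u) ->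
  (forall u, f (x *: u) = x *: f u) ->
  exists F : {linear V -> W}, F =1 f.
Proof.
move=> fD fC fh fg fx; apply: linear_of => b u v.
by rewrite fD (A1_semilinear fD fC fh fg fx).
Qed.
End GeneratorInduction.
End Generators.

(** * Scalars of k acting through [c%:A] *)

Section Scalars.
Variables (k : fieldType) (V : lmodType (A1 k)).
Implicit Types (a b : k) (v : V) (y : A1 k).

Lemma algsA a b v : a%:A *: (b%:A *: v) = (a * b)%:A *: v.
Proof. by rewrite scalerA mulr_algl scalerA. Qed.
Lemma algsC a y v : y *: (a%:A *: v) = a%:A *: (y *: v).
Proof. by rewrite !scalerA mulr_algl mulr_algr. Qed.
Lemma algs1 v : (1 : k)%:A *: v = v.
Proof. by rewrite !scale1r. Qed.
Lemma algs0 v : (0 : k)%:A *: v = 0.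
Proof. by rewrite !scale0r. Qed.
Lemma algsD a b v : (a + b)%:A *: v = a%:A *: v + b%:A *: v.
Proof. by rewrite !scalerDl. Qed.
Lemma algsN a v : (- a)%:A *: v = - (a%:A *: v).
Proof. by rewrite !scaleNr. Qed.
Lemma algs_nat n v : (n%:R : k)%:A *: v = v *+ n.
Proof. by rewrite scaler_nat scaler_nat. Qed.
Lemma algsI a v : a != 0 -> a%:A *: v = 0 -> v = 0.
Proof. by move=> a0 e; rewrite -[v]algs1 -(mulVf a0) -algsA e scaler0. Qed.
End Scalars.

(** Three times the projection onto the trivial and sign components of S_3. Locked, so that
    rewriting treats it as an atom. *)
Definition A1_E (k : fieldType) : A1 k := locked
  (1 + A1_H k (val t12) * A1_H k (val t23) + A1_H k (val t23) * A1_H k (val t12)).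
Definition A1_d (k : fieldType) : A1 k :=
  locked (A1_H k (val t23) - A1_H k (val t13)).

Section CharZero.
Variable k : fieldType.
Hypothesis char0 : [pchar k] =i pred0.
Local Notation A := (A1 k).
Local Notation h := (A1_H k (val t12)).
Local Notation g := (A1_H k (val t23)).
Local Notation t := (A1_H k (val t13)).
Local Notation x := (A1_a k t12).
Local Notation E := (A1_E k).
Local Notation d := (A1_d k).

Lemma natf_neq0_char0 n : (n.+1%:R : k) != 0.
Proof. by have /pcharf0P -> := char0. Qed.

Lemma A1_mulrn_eq0 (V : lmodType A) n (v : V) : v *+ n.+1 = 0 -> v = 0.
Proof. by rewrite -algs_nat; apply: algsI; apply: natf_neq0_char0. Qed.

Let tf2 (y : A) : y + y = 0 -> y = 0.
Proof. by move=> y0; apply: (@A1_mulrn_eq0 A^o 1); rewrite mulr2n. Qed.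
Let tf3 (y : A) : y + y + y = 0 -> y = 0.
Proof. by move=> y0; apply: (@A1_mulrn_eq0 A^o 2); rewrite !mulrSr mulr0n add0r. Qed.

Let hh := A1_hh k.
Let gg := A1_gg k.
Let ghg := A1_ghg k.
Let xh := A1_xh k.
Let xx := A1_xx k.
Let hgh : t = h * g * h. Proof. by rewrite A1_hgh. Qed.

Let dE' : d = g - h * g * h. Proof. by rewrite /A1_d -lock hgh. Qed.
Let EE' : E = 1 + h * g + g * h. Proof. by rewrite /A1_E -lock. Qed.

Lemma A1_EE : E * E = E + E + E.
Proof. by rewrite EE'; apply: (S3_EE hh gg ghg). Qed.
Lemma A1_Ed : E * d = 0.
Proof. by rewrite EE' dE'; apply: (S3_Ed hh gg ghg). Qed.
Lemma A1_dE : d * E = 0.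
Proof. by rewrite EE' dE'; apply: (S3_dE hh gg ghg). Qed.
Lemma A1_dd : d * d = 1 + 1 + 1 - E.
Proof. by rewrite EE' dE'; apply: (S3_dd hh gg ghg). Qed.
Lemma A1_dh : d * h = - (h * d).
Proof. by rewrite dE'; apply: (S3_dh _ hh). Qed.
Lemma A1_Eh : E * h = h * E.
Proof. by rewrite EE'; apply: (S3_Eh _ hh). Qed.
Lemma A1_gE : g + g = h * (E - 1) + d.
Proof. by rewrite EE' dE'; apply: (S3_gE _ hh). Qed.
Lemma A1_tE : t + t = h * (E - 1) - d.
Proof. by rewrite EE' dE' hgh; apply: (S3_tE _ hh). Qed.

Let Sh : (E - 1) * h = h * (E - 1).
Proof. by rewrite mulrBl mulrBr A1_Eh mul1r mulr1. Qed.

Let a13_sqr : - (g * x * g) * - (g * x * g) = 0.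
Proof.
by rewrite mulrNN !mulrA -(mulrA (g * x)) gg mulr1 -(mulrA g) xx mulr0 mul0r.
Qed.

Let a23_sqr : - (t * x * t) * - (t * x * t) = 0.
Proof.
by rewrite mulrNN !mulrA -(mulrA (t * x)) A1_tt mulr1 -(mulrA t) xx mulr0 mul0r.
Qed.

Let rel : x * - (t * x * t) + - (t * x * t) * - (g * x * g) + - (g * x * g) * x
  = 1 - h * g.
Proof. by rewrite -A1_a13 -A1_a23 A1_quad. Qed.

(** The general identities at S = E - 1, a = a_13, b = a_23. *)
Let even0 := even_relation tf2 hh Sh A1_dh A1_gE xh (even_anticomm Sh A1_dh xh)
  (odd_comm Sh A1_dh xh) (quadruple_conj_g Sh A1_dh xh hh A1_gE)
  (quadruple_conj_t Sh A1_dh xh hh A1_tE) a13_sqr a23_sqr rel.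
Let odd0 := odd_relation tf2 hh Sh A1_dh A1_gE xh (even_anticomm Sh A1_dh xh)
  (odd_comm Sh A1_dh xh) (quadruple_conj_g Sh A1_dh xh hh A1_gE)
  (quadruple_conj_t Sh A1_dh xh hh A1_tE) a13_sqr a23_sqr rel.

Section Vectors.
Variable V : lmodType A.
Implicit Types u v w : V.

Lemma actEE v : E *: (E *: v) = (E *: v) *+ 3.
Proof. by rewrite scalerA A1_EE !scalerDl !mulrSr mulr0n add0r. Qed.
Lemma actEd v : E *: (d *: v) = 0.
Proof. by rewrite scalerA A1_Ed scale0r. Qed.
Lemma actdE v : d *: (E *: v) = 0.
Proof. by rewrite scalerA A1_dE scale0r. Qed.
Lemma actdd v : d *: (d *: v) = v *+ 3 - E *: v.
Proof. by rewrite scalerA A1_dd scalerBl !scalerDl scale1r !mulrSr mulr0n add0r. Qed.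
Lemma actdh v : d *: (h *: v) = - (h *: (d *: v)).
Proof. by rewrite !scalerA A1_dh scaleNr. Qed.
Lemma actEh v : E *: (h *: v) = h *: (E *: v).
Proof. by rewrite !scalerA A1_Eh. Qed.
Lemma actxh v : x *: (h *: v) = - (h *: (x *: v)).
Proof. by rewrite !scalerA xh scaleNr. Qed.
Lemma acthh v : h *: (h *: v) = v.
Proof. by rewrite scalerA hh scale1r. Qed.
Lemma actxx v : x *: (x *: v) = 0.
Proof. by rewrite scalerA xx scale0r. Qed.
Lemma actgg v : (g *: v) *+ 2 = h *: (E *: v) - h *: v + d *: v.
Proof. by rewrite mulr2n -scalerDl A1_gE scalerDl mulrBr mulr1 scalerBl scalerA. Qed.

Lemma act_ExExE v : E *: (x *: (E *: (x *: (E *: v)))) = 0.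
Proof.
by rewrite !scalerA (ExExE tf2 tf3 A1_EE A1_Ed A1_dE xx even0) scale0r.
Qed.

Lemma act_ExdxE v : E *: (x *: (d *: (x *: (E *: v)))) = 0.
Proof.
by rewrite !scalerA (ExdxE tf2 tf3 A1_EE A1_Ed A1_dE A1_dd xx odd0) scale0r.
Qed.

Lemma act_ExExdxdxE v :
  E *: (x *: (E *: (x *: (d *: (x *: (d *: (x *: (E *: v))))))))
  = - (E *: (x *: (d *: (x *: (d *: (x *: (E *: (x *: (E *: v))))))))).
Proof.
by rewrite !scalerA (ExExdxdxE tf2 tf3 A1_EE A1_Ed A1_dE A1_dd xx even0 odd0) scaleNr.
Qed.

Lemma act_square_ExdxdxE v :
  E *: (x *: (d *: (x *: (d *: (x *: (E *: (x *: (d *: (x *: (d *: (x *: (E *: v))))))))))))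
  = 0.
Proof.
by rewrite !scalerA (square_ExdxdxE tf2 tf3 A1_EE A1_Ed A1_dE A1_dd xx even0 odd0) scale0r.
Qed.

Lemma act_dxdxdxE v : E *: (x *: (E *: v)) = 0 ->
  d *: (x *: (d *: (x *: (d *: (x *: (E *: v)))))) = - ((d *: (x *: (E *: v))) *+ 4).
Proof.
move=> p0; apply/eqP; rewrite -addr_eq0; apply/eqP; apply: (@A1_mulrn_eq0 V 2).
have /(congr1 (fun y => y *: v)) := dxdxdxE tf2 tf3 A1_EE A1_Ed A1_dE A1_dd xx even0 odd0.
rewrite !mulrDr !mulr1 scalerBl !scalerDl -!scalerA p0 !scaler0 sub0r => e.
rewrite mulrnDl -mulrnA !mulrSr !mulr0n !add0r e addrC.
by apply/eqP; rewrite subr_eq0 !addrA.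
Qed.

Lemma act_dxdx_xdxd : (forall v, E *: v = 0) ->
  forall v, d *: (x *: (d *: (x *: v))) + x *: (d *: (x *: (d *: v))) = - (v *+ 4).
Proof.
move=> E0 v; apply/eqP; rewrite -addr_eq0; apply/eqP; apply: (@A1_mulrn_eq0 V 2).
have /(congr1 (fun y => y *: v)) := dxdx_xdxd A1_EE A1_Ed A1_dE A1_dd xx even0.
rewrite !(mulrDl, mulrDr, mulr1, mul1r, mulNr, mulrN) !scalerDl !scaleNr -!scalerA.
rewrite !E0 !scaler0 ?scale1r !(oppr0, addr0) => e.
by rewrite 2!mulrnDl -mulrnA !mulrSr !mulr0n !add0r -[RHS]e !addrA.
Qed.

(* On the image of E, the operators E x and E x d x d x anticommute and have
   square zero, hence a common kernel. *)
Lemma exists_killed w : E *: w != 0 ->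
  exists2 v : V, E *: v != 0 &
  E *: (x *: (E *: v)) = 0 /\ E *: (x *: (d *: (x *: (d *: (x *: (E *: v)))))) = 0.
Proof.
move=> w0; pose p v := x *: (E *: v).
pose q v := x *: (d *: (x *: (d *: (x *: (E *: v))))).
have pp v : E *: p (p v) = 0 by exact: act_ExExE.
have qq v : E *: q (q v) = 0 by exact: act_square_ExdxdxE.
have pq v : E *: p (q v) = - (E *: q (p v)) by exact: act_ExExdxdxE.
have pE u : E *: u = 0 -> E *: p u = 0 by rewrite /p => ->; rewrite !scaler0.
have qE u : E *: u = 0 -> E *: q u = 0 by rewrite /q => ->; rewrite !scaler0.
suff [v v0 [pv qv]] : exists2 v : V, E *: v != 0 & E *: p v = 0 /\ E *: q v = 0.
  by exists v.
(* Among p (q w), p w, q w, w, the first one not killed by E is the vector sought. *)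
have [pqw|n0] := eqVneq (E *: p (q w)) 0; last first.
  exists (p (q w)) => //; split=> //.
  by apply/eqP; rewrite -oppr_eq0 -pq pE.
have [pw|n0] := eqVneq (E *: p w) 0; last first.
  by exists (p w) => //; split=> //; apply/eqP; rewrite -oppr_eq0 -pq pqw.
have [qw|n0] := eqVneq (E *: q w) 0; last by exists (q w).
by exists w.
Qed.

(** Either v + h v is nonzero and fixed by h, or h v = - v. *)
Lemma h_eigenvector (P : V -> Prop) v : v != 0 -> P v ->
  (forall u, P u -> P (h *: u)) -> (forall u w, P u -> P w -> P (u + w)) ->
  exists2 u : V, u != 0 & P u /\ (h *: u = u \/ h *: u = - u).
Proof.
move=> v0 Pv Ph PD.
have [v1|n0] := eqVneq (v + h *: v) 0.
  exists v => //; split=> //; right.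
  by apply/eqP; rewrite -addr_eq0 addrC v1.
exists (v + h *: v) => //; split; first by apply: PD => //; apply: Ph.
by left; rewrite scalerDr acthh addrC.
Qed.

(* The last equation makes d x act on v and d x v with eigenvalues +-2i. *)
Definition standard_seed (v : V) : Prop :=
  [/\ E *: v = 0, E *: (x *: v) = 0, E *: (x *: (d *: (x *: v))) = 0,
      x *: (d *: v) = 0 & d *: (x *: (d *: (x *: v))) = - (v *+ 4)].

(** The first alternative leads to a one-dimensional module, the second to a standard one. *)
Lemma simple_seed v : v != 0 ->
  (exists u : V, [/\ u != 0, x *: u = 0, E *: u = u *+ 3 & h *: u = u \/ h *: u = - u])
  \/ (exists u : V, [/\ u != 0, standard_seed u & h *: u = u \/ h *: u = - u]).
Proof.
move=> v0; suff: (exists2 u : V, u != 0 & E *: u = u *+ 3 /\ x *: u = 0) \/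
   exists2 u : V, u != 0 & standard_seed u.
  case=> [[u u0 Pu]|[u u0 Pu]]; [left|right].
    have [] := @h_eigenvector (fun u => E *: u = u *+ 3 /\ x *: u = 0) _ u0 Pu.
    - by move=> w [Ew xw]; rewrite actEh Ew actxh xw scaler0 oppr0 scalerMnr.
    - by move=> w w' [Ew xw] [Ew' xw']; rewrite !scalerDr Ew Ew' xw xw' addr0 mulrnDl.
    by move=> w w0 [[Ew xw] hw]; exists w.
  have [] := @h_eigenvector standard_seed _ u0 Pu.
  - have act_h := (actxh, actdh, actEh, @scalerN A V, @opprK V).
    move=> w [e1 e2 e3 e4 e5]; split.
    + by rewrite !act_h e1 scaler0.
    + by rewrite !act_h e2 scaler0 ?oppr0.
    + by rewrite !act_h e3 scaler0 ?oppr0.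
    + by rewrite !act_h e4 scaler0 ?oppr0.
    + by rewrite !act_h e5 scalerN scalerMnr.
  - move=> w w' [e1 e2 e3 e4 e5] [f1 f2 f3 f4 f5]; split.
    + by rewrite scalerDr e1 f1 addr0.
    + by rewrite !scalerDr e2 f2 addr0.
    + by rewrite !scalerDr e3 f3 addr0.
    + by rewrite !scalerDr e4 f4 addr0.
    + by rewrite !scalerDr e5 f5 -opprD -mulrnDl.
  by move=> w w0 [sw hw]; exists w.
(* If E kills V, every u with x d u = 0 is a seed by [act_dxdx_xdxd]. As d d = 3 on such V, d x v is
   one if nonzero, and otherwise x v = 0 and d v is one. *)
have [E0|] := pselect (forall u, E *: u = 0).
  right; suff [u u0 [xd dxdx]] : exists2 u : V, u != 0 &
      x *: (d *: u) = 0 /\ d *: (x *: (d *: (x *: u))) = - (u *+ 4) by exists u.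
  have key u : x *: (d *: u) = 0 -> d *: (x *: (d *: (x *: u))) = - (u *+ 4).
    by move=> xd; rewrite -act_dxdx_xdxd // xd !scaler0 addr0.
  have [dxv|n0] := eqVneq (d *: (x *: v)) 0.
    have xv : x *: v = 0.
      by apply: (@A1_mulrn_eq0 V 2); rewrite -[LHS]subr0 -(E0 (x *: v)) -actdd dxv scaler0.
    exists (d *: v).
      apply: contraNneq v0 => dv; apply/eqP.
      by apply: (@A1_mulrn_eq0 V 2); rewrite -[LHS]subr0 -(E0 v) -actdd dv scaler0.
    suff e : x *: (d *: (d *: v)) = 0 by split=> //; apply: key.
    by rewrite actdd E0 subr0 -scalerMnr xv mul0rn.
  exists (d *: (x *: v)) => //.
  suff e : x *: (d *: (d *: (x *: v))) = 0 by split=> //; apply: key.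
  by rewrite actdd E0 subr0 -scalerMnr actxx mul0rn.
move=> /existsNP[w /eqP /exists_killed[{}w w0 [pw qw]]].
(* If d x E w = 0, then 3 x E w = d d x E w + E x E w = 0. *)
have [dxw|n0] := eqVneq (d *: (x *: (E *: w))) 0.
  left; exists (E *: w) => //; split; first exact: actEE.
  by apply: (@A1_mulrn_eq0 V 2); rewrite -[LHS]subr0 -pw -actdd dxw scaler0.
right; exists (d *: (x *: (E *: w))) => //; split.
- exact: actEd.
- exact: act_ExdxE.
- exact: qw.
- by rewrite actdd pw subr0 -scalerMnr actxx mul0rn.
- exact: act_dxdxdxE.
Qed.

(** With u' = d x u one has d x u' = -4 u, so u' + j u is an eigenvector of d x for j; if it
    vanishes, u is one for -j. Since E x w = 0, the eigenvalue equation becomes 3 x w = d d x w = c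
    d w. The sign of h persists because d x commutes with h. *)
Lemma standard_eigenvector (j : k) (u : V) : j ^+ 2 = - 4%:R ->
  u != 0 -> standard_seed u -> (h *: u = u \/ h *: u = - u) ->
  exists w : V, exists c : k, [/\ w != 0, c = j \/ c = - j, E *: w = 0, x *: (d *: w) = 0 &
    (x *: w) *+ 3 = c%:A *: (d *: w) /\ (h *: w = w \/ h *: w = - w)].
Proof.
move=> j2 u0 [Eu Exu Exdxu xdu dxdxu] hu.
pose u' := d *: (x *: u).
have hu' : h *: u' = u' /\ h *: u = u \/ h *: u' = - u' /\ h *: u = - u.
  have e : h *: u' = d *: (x *: (h *: u)) by rewrite actxh scalerN actdh opprK.
  by case: hu => hu; [left|right]; split=> //; rewrite e hu ?scalerN.
have xu : (x *: u) *+ 3 = d *: u' by rewrite actdd Exu subr0.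
have xu' : (x *: u') *+ 3 = - ((d *: u) *+ 4).
  by rewrite -[LHS]subr0 -Exdxu -actdd dxdxu scalerN scalerMnr.
have xdu' : x *: (d *: u') = 0 by rewrite -xu -scalerMnr actxx mul0rn.
have [e|n0] := eqVneq (u' + j%:A *: u) 0.
  exists u, (- j); split=> //; first by right.
  split; last by case: hu' => -[_ ->]; [left | right].
  rewrite xu algsN -(algsC j d u) -scalerN; congr (_ *: _).
  by apply/eqP; rewrite -addr_eq0 e.
exists (u' + j%:A *: u), j; split=> //; first by left.
- by rewrite scalerDr algsC Eu scaler0 addr0 actEd.
- by rewrite !(scalerDr, algsC) xdu' xdu scaler0 addr0.
- split; last first.
    by case: hu' => -[h1 h2]; [left|right]; rewrite scalerDr algsC h1 h2 ?scalerN ?opprD.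
  rewrite scalerDr algsC mulrnDl (scalerMnr j%:A) xu' xu scalerDr algsC scalerDr algsA.
  by rewrite -expr2 j2 algsN algs_nat addrC.
Qed.
End Vectors.
End CharZero.

(** * The simple modules *)

Section Morphisms.
Variable k : fieldType.
Local Notation A := (A1 k).
Local Notation h := (A1_H k (val t12)).
Local Notation g := (A1_H k (val t23)).
Local Notation x := (A1_a k t12).

Lemma rep_modC n (r : A1_rep k n) (c : k) (u : rep_mod r) :
  c%:A *: u = c *: (u : 'cV[k]_n).
Proof. by rewrite -A1_clsC [LHS]rep_actE mul_scalar_mx. Qed.

Lemma rep_hom n (r : A1_rep k n) (V : lmodType A) (e : 'I_n -> V) :
  (forall c, h *: e c = \sum_j (rep_H r (val t12) j c)%:A *: e j) ->
  (forall c, g *: e c = \sum_j (rep_H r (val t23) j c)%:A *: e j) ->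
  (forall c, x *: e c = \sum_j (rep_a r t12 j c)%:A *: e j) ->
  exists f : {linear rep_mod r -> V},
    forall u : 'cV[k]_n, f u = \sum_c (u c 0)%:A *: e c.
Proof.
move=> eh eg ex; pose f (u : rep_mod r) := \sum_c ((u : 'cV[k]_n) c 0)%:A *: e c.
suff [F FE] : exists F : {linear rep_mod r -> V}, F =1 f by exists F => u; exact: FE.
have fM (B : 'M[k]_n) (b : A) : (forall c, b *: e c = \sum_j (B j c)%:A *: e j) ->
    forall u : 'cV[k]_n, f (B *m u) = b *: f u.
  move=> eB u; rewrite /f scaler_sumr.
  under eq_bigr => c _ do rewrite mxE scaler_suml scaler_suml.
  rewrite exchange_big /=; apply: eq_bigr => j _.
  rewrite algsC eB scaler_sumr; apply: eq_bigr => c _.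
  by rewrite algsA mulrC.
apply: A1_linear_of => [u v|c u|u|u|u].
- by rewrite /f -big_split /=; apply: eq_bigr => c _; rewrite mxE algsD.
- rewrite rep_modC /f scaler_sumr; apply: eq_bigr => j _.
  by rewrite mxE algsA.
- by rewrite rep_modH; apply: fM.
- by rewrite rep_modH; apply: fM.
- by rewrite rep_moda; apply: fM.
Qed.
End Morphisms.

(** Schur's lemma: the kernel of f is not S and its image is not 0. *)
Lemma simple_iso_mod (R : pzRingType) (V S : lmodType R) (f : {linear S -> V}) s :
  simple_mod V -> simple_mod S -> f s != 0 -> iso_mod V S.
Proof.
move=> [_ simV] [_ simS] fs0.
have inj_f : injective f.
  have [|K0|KT] := simS [pred u | f u == 0].
  - split; first by rewrite inE linear0.
    by move=> a u v; rewrite !inE linearP => /eqP-> /eqP->; rewrite scaler0 addr0.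
  - move=> u v fuv; apply/eqP; rewrite -subr_eq0.
    by move: (K0 (u - v)); rewrite !inE linearB fuv subrr eqxx => /esym.
  - by move: (KT s); rewrite !inE (negPf fs0).
have surj_f v : exists u, f u = v.
  have [|K0|KT] := simV [pred v | `[< exists u, f u = v >]].
  - split; first by apply/asboolP; exists 0; rewrite linear0.
    move=> a _ _ /asboolP[u <-] /asboolP[u' <-]; apply/asboolP.
    by exists (a *: u + u'); rewrite linearP.
  - move: (K0 (f s)); rewrite !inE (negPf fs0) => /negP[].
    by apply/asboolP; exists s.
  - by move: (KT v); rewrite !inE => /asboolP.
pose f' v := projT1 (cid (surj_f v)).
have f'K : cancel f' f by move=> v; rewrite /f'; case: cid.
have fK : cancel f f' by move=> u; apply: inj_f; rewrite f'K.
have lf' : linear f' by move=> a u v; apply: inj_f; rewrite linearP !f'K.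
have [F FE] := linear_of lf'.
by exists F; exists f => v; rewrite ?FE.
Qed.

Lemma iso_mod_annihilator (R : pzRingType) (V W : lmodType R) (b : R) :
  iso_mod V W -> (forall v : V, b *: v = 0) <-> (forall w : W, b *: w = 0).
Proof.
move=> [f [f' fK f'K]]; split=> b0 v.
  by rewrite -[v]f'K -linearZZ b0 linear0.
by apply: (can_inj fK); rewrite linearZZ b0 linear0.
Qed.

Lemma simple_modP (R : pzRingType) (V : lmodType R) (v : V) : v != 0 ->
  (forall U : {pred V}, submod_closed U -> forall u, u \in U -> u != 0 ->
     forall w, w \in U) -> simple_mod V.
Proof.
move=> v0 gen; split; first by exists v.
move=> U cU; have [[u uU u0]|noU] := pselect (exists2 u, u \in U & u != 0).
  by right=> w; rewrite !inE (gen U cU u uU u0).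
left=> w; rewrite !inE; apply/idP/eqP => [wU|->]; last by case: cU.
by apply/eqP; apply: contra_notT noU => w0; exists w.
Qed.

Section SimpleModules.
Variable k : fieldType.
Hypothesis char0 : [pchar k] =i pred0.
Local Notation A := (A1 k).
Local Notation h := (A1_H k (val t12)).
Local Notation g := (A1_H k (val t23)).
Local Notation x := (A1_a k t12).
Local Notation E := (A1_E k).
Local Notation d := (A1_d k).

Definition is_character (r : A1_rep k 1) (eta : k) :=
  [/\ rep_H r (val t12) = eta%:M, rep_H r (val t23) = eta%:M & rep_a r t12 = 0].

(** Treats the four S_st(theta) at once: q = theta for +-i and q = - theta for +-i/3, with p =
    theta. Anticommutation with H_12 forces the shape of the matrix. *)
Definition is_standard (r : A1_rep k 2) (p q : k) :=
  rep_H r =1 @st_H k /\ rep_a r t12 = mx2 p q (- q) (- p).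

Definition cv2 (a b : k) : 'cV[k]_2 := \col_i (if i == 0 then a else b).

Lemma cv2P (u : 'cV[k]_2) : u = cv2 (u 0 0) (u 1 0).
Proof.
apply/colP => i; rewrite mxE; case: i => -[|[|[|//]]] lt_i /=;
  by congr (u _ _); apply: val_inj.
Qed.

Lemma mx2_cv2 a b c e a' b' :
  mx2 a b c e *m cv2 a' b' = cv2 (a * a' + b * b') (c * a' + e * b').
Proof.
by rewrite [LHS]cv2P; congr (cv2 _ _); rewrite mxE !big_ord_recl big_ord0 !mxE addr0.
Qed.

Lemma cv2D a b a' b' : cv2 a b + cv2 a' b' = cv2 (a + a') (b + b').
Proof. by rewrite [LHS]cv2P !mxE. Qed.
Lemma cv2N a b : - cv2 a b = cv2 (- a) (- b).
Proof. by rewrite [LHS]cv2P !mxE. Qed.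
Lemma cv2Z c a b : c *: cv2 a b = cv2 (c * a) (c * b).
Proof. by rewrite [LHS]cv2P !mxE. Qed.
Lemma cv2_eq0 a b : (cv2 a b == 0) = (a == 0) && (b == 0).
Proof.
apply/eqP/andP => [e|[/eqP-> /eqP->]]; last by rewrite [RHS]cv2P !mxE.
have := congr1 (fun u : 'cV[k]_2 => u 0 0) e.
by have := congr1 (fun u : 'cV[k]_2 => u 1 0) e; rewrite !mxE /= => -> ->.
Qed.

Section Standard.
Variables (r : A1_rep k 2) (p q : k).
Hypothesis st_r : is_standard r p q.

Lemma std_h a b : h *: (cv2 a b : rep_mod r) = (cv2 b a : rep_mod r).
Proof.
rewrite rep_modH (st_r.1) st_H12 mx2_cv2; congr (cv2 _ _); ring.
Qed.
Lemma std_g a b : g *: (cv2 a b : rep_mod r) = (cv2 a (- a - b) : rep_mod r).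
Proof.
rewrite rep_modH (st_r.1) st_H23 mx2_cv2; congr (cv2 _ _); ring.
Qed.
Lemma std_t a b : A1_H k (val t13) *: (cv2 a b : rep_mod r) = (cv2 (- a - b) b : rep_mod r).
Proof.
rewrite rep_modH (st_r.1) st_H13 mx2_cv2; congr (cv2 _ _); ring.
Qed.
Lemma std_x a b : x *: (cv2 a b : rep_mod r) =
  (cv2 (p * a + q * b) (- (q * a + p * b)) : rep_mod r).
Proof.
rewrite rep_moda (st_r.2) mx2_cv2; congr (cv2 _ _); ring.
Qed.
Lemma std_C c a b : c%:A *: (cv2 a b : rep_mod r) = (cv2 (c * a) (c * b) : rep_mod r).
Proof. by rewrite rep_modC cv2Z. Qed.
Lemma std_D a b a' b' : (cv2 a b : rep_mod r) + (cv2 a' b' : rep_mod r)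
  = (cv2 (a + a') (b + b') : rep_mod r).
Proof. exact: cv2D. Qed.
Lemma std_N a b : - (cv2 a b : rep_mod r) = (cv2 (- a) (- b) : rep_mod r).
Proof. exact: cv2N. Qed.
Lemma std_d a b : d *: (cv2 a b : rep_mod r) = (cv2 (a *+ 2 + b) (- (a + b *+ 2)) : rep_mod r).
Proof.
rewrite /A1_d -lock scalerBl std_g std_t std_N std_D.
congr (cv2 _ _); ring.
Qed.
Lemma std_E (u : rep_mod r) : E *: u = 0.
Proof.
rewrite (cv2P u) /A1_E -lock !scalerDl scale1r -!scalerA std_g !std_h std_g !std_D.
apply/eqP; rewrite [_ == _]cv2_eq0; apply/andP; split; apply/eqP; ring.
Qed.

(** W_st is already simple over S_3: [d] exchanges the lines of the two eigenvectors [cv2 1 1] and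
    [cv2 1 (-1)] of [h], and u + h u, or u itself if that sum is 0, lies on one of them. *)
Lemma standard_simple : simple_mod (rep_mod r).
Proof.
apply: (@simple_modP _ _ (cv2 1 1 : rep_mod r)).
  by rewrite [_ == _]cv2_eq0 oner_eq0.
move=> U [U0 cU] u uU u0 w.
have UZ b v : v \in U -> b *: v \in U by move=> vU; rewrite -[_ *: _]addr0; apply: cU.
have UD v v' : v \in U -> v' \in U -> v + v' \in U.
  by move=> vU v'U; rewrite -[v]scale1r; apply: cU.
have n2 := natf_neq0_char0 char0 1; have n3 := natf_neq0_char0 char0 2.
suff [plusU minusU] : (cv2 1 1 : rep_mod r) \in U /\ (cv2 1 (-1) : rep_mod r) \in U.
  have -> : w = (((w : 'cV_2) 0 0 + (w : 'cV_2) 1 0) / 2%:R)%:A *: (cv2 1 1 : rep_mod r)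
     + (((w : 'cV_2) 0 0 - (w : 'cV_2) 1 0) / 2%:R)%:A *: (cv2 1 (-1) : rep_mod r).
    rewrite !std_C std_D {1}(cv2P w).
    by congr (cv2 _ _); field.
  by apply: (UD); apply: (UZ).
have plus_minus : (cv2 1 1 : rep_mod r) \in U -> (cv2 1 (-1) : rep_mod r) \in U.
  have <- : (3%:R^-1)%:A *: (d *: (cv2 1 1 : rep_mod r)) = (cv2 1 (-1) : rep_mod r).
    by rewrite std_d std_C; congr (cv2 _ _); field.
  by move=> ?; apply: (UZ); apply: (UZ).
have minus_plus : (cv2 1 (-1) : rep_mod r) \in U -> (cv2 1 1 : rep_mod r) \in U.
  have <- : d *: (cv2 1 (-1) : rep_mod r) = (cv2 1 1 : rep_mod r).
    by rewrite std_d; congr (cv2 _ _); ring.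
  by move=> ?; apply: (UZ).
suff: (cv2 1 1 : rep_mod r) \in U \/ (cv2 1 (-1) : rep_mod r) \in U.
  by case=> ?; split; auto.
set a := (u : 'cV_2) 0 0; set b := (u : 'cV_2) 1 0.
have uE : u = (cv2 a b : rep_mod r) by exact: cv2P.
have [ab|ab0] := eqVneq (a + b) 0.
  right; have bE : b = - a by apply/eqP; rewrite -addr_eq0 addrC ab.
  have a0 : a != 0.
    by apply: contraNneq u0 => a0; rewrite uE bE [_ == _]cv2_eq0 a0 oppr0 eqxx.
  have -> : (cv2 1 (-1) : rep_mod r) = (a^-1)%:A *: u.
    by rewrite uE bE std_C; congr (cv2 _ _); field.
  exact: UZ.
left; have -> : (cv2 1 1 : rep_mod r) = ((a + b)^-1)%:A *: (u + h *: u).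
  rewrite uE std_h std_D std_C.
  by congr (cv2 _ _); field.
by apply: (UZ); apply: (UD) => //; apply: (UZ).
Qed.
End Standard.

Section Character.
Variables (r : A1_rep k 1) (eta : k).
Hypothesis ch_r : is_character r eta.

Lemma char_h (u : rep_mod r) : h *: u = eta%:A *: u.
Proof. by case: ch_r => e _ _; rewrite rep_modH e mul_scalar_mx rep_modC. Qed.
Lemma char_g (u : rep_mod r) : g *: u = eta%:A *: u.
Proof. by case: ch_r => _ e _; rewrite rep_modH e mul_scalar_mx rep_modC. Qed.
Lemma char_eta2 : eta * eta = 1.
Proof.
have := acthh (1%:M : rep_mod r); rewrite !char_h algsA rep_modC.
by move/(congr1 (fun u : 'cV[k]_1 => u 0 0)); rewrite !mxE eqxx mulr1.
Qed.
Lemma char_E (u : rep_mod r) : E *: u = u *+ 3.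
Proof.
rewrite /A1_E -lock !scalerDl -!scalerA !(char_h, char_g) algsA char_eta2.
by rewrite scale1r algs1 !mulrSr mulr0n add0r.
Qed.

Lemma character_simple : simple_mod (rep_mod r).
Proof.
apply: (@simple_modP _ _ (1%:M : rep_mod r)).
  apply/eqP => /(congr1 (fun u : 'cV[k]_1 => u 0 0)); rewrite !mxE => /eqP.
  by rewrite oner_eq0.
move=> U [U0 cU] u uU u0 w.
have u00 : (u : 'cV[k]_1) 0 0 != 0.
  apply: contraNneq u0 => e; apply/eqP/colP => j.
  by rewrite [j]ord1 [LHS]e mxE.
have -> : w = ((w : 'cV_1) 0 0 / (u : 'cV_1) 0 0)%:A *: u + 0.
  by rewrite addr0 rep_modC; apply/colP => j; rewrite [j]ord1 mxE divfK.
exact: cU.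
Qed.
End Character.
End SimpleModules.

(** * Classification of the simple modules *)

Section Classification.
Variable k : fieldType.
Hypothesis char0 : [pchar k] =i pred0.
Variables (i : k) (i2 : i ^+ 2 = -1).
Local Notation A := (A1 k).
Local Notation h := (A1_H k (val t12)).
Local Notation g := (A1_H k (val t23)).
Local Notation x := (A1_a k t12).
Local Notation E := (A1_E k).
Local Notation d := (A1_d k).
Local Notation S := (A1_simples char0 i2).

Lemma character_hom (r : A1_rep k 1) eta (V : lmodType A) (u : V) :
  is_character r eta -> u != 0 -> h *: u = eta%:A *: u -> g *: u = eta%:A *: u ->
  x *: u = 0 -> exists (f : {linear rep_mod r -> V}) s, f s != 0.
Proof.
move=> [rh rg rx] u0 hu gu xu.
have [|||f fE] := @rep_hom k 1 r V (fun=> u).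
- by move=> c; rewrite big_ord_recl big_ord0 addr0 rh mxE [c]ord1 eqxx.
- by move=> c; rewrite big_ord_recl big_ord0 addr0 rg mxE [c]ord1 eqxx.
- by move=> c; rewrite big_ord_recl big_ord0 addr0 rx mxE algs0.
by exists f, 1%:M; rewrite fE big_ord_recl big_ord0 addr0 mxE eqxx algs1.
Qed.

Lemma standard_hom (r : A1_rep k 2) p q (V : lmodType A) (v w : V) :
  is_standard r p q -> v != 0 -> h *: v = w -> h *: w = v ->
  g *: v = v - w -> g *: w = - w ->
  x *: v = p%:A *: v - q%:A *: w -> x *: w = q%:A *: v - p%:A *: w ->
  exists (f : {linear rep_mod r -> V}) s, f s != 0.
Proof.
move=> [rh rx] v0 hv hw gv gw xv xw.
have [|||f fE] := @rep_hom k 2 r V (fun c => if c == 0 then v else w).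
- move=> c; rewrite !big_ord_recl big_ord0 addr0 rh st_H12 !mxE /=.
  by case: ifP => _; rewrite algs1 algs0 ?addr0 ?add0r.
- move=> c; rewrite !big_ord_recl big_ord0 addr0 rh st_H23 !mxE /=.
  by case: ifP => _; rewrite ?algsN ?algs1 ?algs0 ?add0r.
- move=> c; rewrite !big_ord_recl big_ord0 addr0 rx !mxE /=.
  by case: ifP => _; rewrite !algsN.
exists f, (cv2 1 0); rewrite fE !big_ord_recl big_ord0 addr0 !mxE /=.
by rewrite algs1 algs0 addr0.
Qed.

(** Indices are those of ['I_6]: 2 to 5 stand for the vertices 3 to 6. *)
Definition simple_p (j : nat) : k :=
  match j with 2 => i | 3 => - i | 4 => i / 3%:R | _ => - (i / 3%:R) end%N.
Definition simple_q (j : nat) : k :=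
  match j with 2 => i | 3 => - i | 4 => - (i / 3%:R) | _ => i / 3%:R end%N.

Lemma A1_simplesP (j : 'I_6) :
  (exists2 r, S j = rep_mod r & is_character r ((-1) ^+ j) /\ (j < 2)%N) \/
  (exists2 r, S j = rep_mod r & is_standard r (simple_p j) (simple_q j) /\ (1 < j)%N).
Proof.
case: j => -[|[|[|[|[|[|//]]]]]] lt_j.
- by left; exists (A1Rep (rep_triv_rel k)).
- left; exists (A1Rep (rep_sgn_rel k)) => //; split=> //.
  by split=> //=; rewrite odd_tperm /= !expr1 rmorphN1.
- right; exists (A1Rep (S_st_i_rel i2)) => //; split=> //.
  by split=> //=; rewrite /st_a eqxx.
- right; exists (A1Rep (S_st_i_rel (sqr_opp_i i2))) => //; split=> //.
  by split=> //=; rewrite /st_a eqxx.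
- right; exists (A1Rep (S_st_i3_rel (sqr_i3 char0 i2))) => //; split=> //.
  by split=> //=; rewrite /st_a eqxx /st_a12_i3 /simple_q opprK.
- right; exists (A1Rep (S_st_i3_rel (sqr_opp_i3 char0 i2))) => //; split=> //.
  by split=> //=; rewrite /st_a eqxx /st_a12_i3 /simple_q opprK.
Qed.

Lemma A1_simples_simple j : simple_mod (S j).
Proof.
have [[r -> [cr _]]|[r -> [sr _]]] := A1_simplesP j; first exact: character_simple.
exact: standard_simple sr.
Qed.

Lemma i_neq0 : i != 0.
Proof.
apply: contra_eq_neq i2 => ->; rewrite expr0n /= eq_sym oppr_eq0; exact: oner_neq0.
Qed.

Lemma natf_inj_char0 m n : m%:R = n%:R :> k -> m = n.
Proof.
wlog le_mn : m n / (m <= n)%N => [H e|].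
  by case/orP: (leq_total m n) => le; [|apply: esym]; apply: H.
move/eqP; rewrite eq_sym -subr_eq0 -natrB //; have /pcharf0P -> := char0.
by rewrite subn_eq0 => le_nm; apply/eqP; rewrite eqn_leq le_mn.
Qed.

Lemma simple_p_inj (j l : 'I_6) : (1 < j)%N -> (1 < l)%N ->
  simple_p j = simple_p l -> j = l.
Proof.
have n3 := natf_neq0_char0 char0 2.
(* 3 p + 3 i takes the values 6 i, 0, 4 i, 2 i, natural multiples of i that characteristic 0 keeps
   apart. *)
pose m (j : nat) := match j with 2 => 6 | 3 => 0 | 4 => 4 | _ => 2 end%N.
have mE (a : nat) : simple_p a * 3%:R + i * 3%:R = (m a)%:R * i.
  by case: a => [|[|[|[|[|a]]]]]; rewrite /simple_p /m; field.
move=> j1 l1 e.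
have: m j = m l by apply: natf_inj_char0; apply: (mulIf i_neq0); rewrite -!mE e.
case: j j1 {e} => -[|[|[|[|[|[|//]]]]]] lt_j //; case: l l1 => -[|[|[|[|[|[|//]]]]]] lt_l // _ _ _;
  exact: val_inj.
Qed.

(** Annihilators separate the modules: [h] minus its sign for two characters, [E] (3 on characters,
    0 on standard modules) for mixed pairs, [z] for two standard modules. *)
Lemma A1_simples_inj j l : iso_mod (S j) (S l) -> j = l.
Proof.
have [[r -> [cr jr]]|[r -> [sr jr]]] := A1_simplesP j;
  have [[s -> [cs ls]]|[s -> [ss ls]]] := A1_simplesP l => iso_rs.
- have /(iso_mod_annihilator _ iso_rs)/(_ (1%:M : rep_mod s)) :
      forall v : rep_mod r, (h - ((-1) ^+ j)%:A) *: v = 0.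
    by move=> v; rewrite scalerBl (char_h cr) subrr.
  rewrite scalerBl (char_h cs) -scalerBl -scalerBl rep_modC.
  move/(congr1 (fun u : 'cV[k]_1 => u 0 0)); rewrite !mxE eqxx mulr1 => /eqP.
  rewrite subr_eq0; case: j jr {cr iso_rs} => -[|[|//]] lt_j _;
    case: l ls {cs} => -[|[|//]] lt_l _ /=; rewrite ?expr0 ?expr1 => e; try exact: val_inj.
    move: e; rewrite eq_sym -subr_eq0 opprK -(natrD _ 1 1).
    by rewrite (negPf (natf_neq0_char0 char0 1)).
  move: e; rewrite -subr_eq0 opprK -(natrD _ 1 1).
  by rewrite (negPf (natf_neq0_char0 char0 1)).
- have /(iso_mod_annihilator _ iso_rs)/(_ (1%:M : rep_mod r)) : forall v : rep_mod s, E *: v = 0.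
    exact: std_E ss.
  rewrite (char_E cr) => /(A1_mulrn_eq0 char0) /(congr1 (fun u : 'cV[k]_1 => u 0 0)).
  by rewrite !mxE eqxx => /eqP; rewrite oner_eq0.
- have /(iso_mod_annihilator _ iso_rs)/(_ (1%:M : rep_mod s)) : forall v : rep_mod r, E *: v = 0.
    exact: std_E sr.
  rewrite (char_E cs) => /(A1_mulrn_eq0 char0) /(congr1 (fun u : 'cV[k]_1 => u 0 0)).
  by rewrite !mxE eqxx => /eqP; rewrite oner_eq0.
- apply: simple_p_inj => //; apply/esym/eqP; rewrite -subr_eq0.
  (* With parameters (p, q), 6 x acts as the group algebra element (p + q) d (1 + h) + 3 (p - q) d
     (1 - h). Hence [z p q] kills that module, and on another one its value at [cv2 1 0] compares
     the parameters p. *)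
  pose z p q : A := (6%:R : k)%:A * x - (p + q)%:A * (d * (1 + h))
    - ((p - q) * 3%:R)%:A * (d * (1 - h)).
  have zE (r' : A1_rep k 2) p' q' p q a b : is_standard r' p' q' ->
      z p q *: (cv2 a b : rep_mod r') =
      (cv2 (((p' - p) * a + (q' - q) * b) *+ 6)
        (- (((q' - q) * a + (p' - p) * b) *+ 6)) : rep_mod r').
    move=> sr'; have dp (v : rep_mod r') : (d * (1 + h)) *: v = d *: (v + h *: v).
      by rewrite -scalerA scalerDl scale1r.
    have dm (v : rep_mod r') : (d * (1 - h)) *: v = d *: (v - h *: v).
      by rewrite -scalerA scalerBl scale1r.
    rewrite /z 2!scalerBl -[X in X - _ - _]scalerA -[X in _ - X - _]scalerA.
    rewrite -[X in _ - _ - X]scalerA dp dm (std_x sr') (std_h sr').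
    rewrite std_N !std_D !(std_d sr').
    rewrite !std_C !std_N !std_D; congr (cv2 _ _); ring.
  have /(iso_mod_annihilator _ iso_rs)/(_ (cv2 1 0 : rep_mod s)) :
      forall v : rep_mod r, z (simple_p j) (simple_q j) *: v = 0.
    move=> v; rewrite (cv2P v) (zE _ _ _ _ _ _ _ sr).
    by apply/eqP; rewrite [_ == _]cv2_eq0 !subrr !mul0r addr0 mul0rn oppr0 eqxx.
  rewrite (zE _ _ _ _ _ _ _ ss) => /eqP; rewrite [_ == _]cv2_eq0 => /andP[+ _].
  rewrite mulr1 mulr0 addr0 -mulr_natr mulf_eq0.
  by rewrite (negPf (natf_neq0_char0 char0 5)) orbF.
Qed.

Lemma A1_simples_complete (V : lmodType A) : simple_mod V -> exists j, iso_mod V (S j).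
Proof.
move=> simV; have [[v v0] _] := simV.
suff [j [f [s fs]]] : exists j (f : {linear S j -> V}) s, f s != 0.
  exists j; exact: simple_iso_mod simV (A1_simples_simple j) fs.
have of_char (eta : k) (j : 'I_6) (u : V) : (j < 2)%N -> (-1) ^+ j = eta ->
    u != 0 -> h *: u = eta%:A *: u -> g *: u = eta%:A *: u -> x *: u = 0 ->
    exists j (f : {linear S j -> V}) s, f s != 0.
  move=> j2 je u0 hu gu xu; exists j.
  have [[r -> [cr _]]|[r _ [_]]] := A1_simplesP j; last by rewrite ltnNge -ltnS j2.
  by move: cr; rewrite je => cr; apply: character_hom cr u0 hu gu xu.
have of_std (j : 'I_6) (u w : V) p q : (1 < j)%N -> simple_p j = p -> simple_q j = q ->
    u != 0 -> h *: u = w -> h *: w = u -> g *: u = u - w -> g *: w = - w ->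
    x *: u = p%:A *: u - q%:A *: w -> x *: w = q%:A *: u - p%:A *: w ->
    exists j (f : {linear S j -> V}) s, f s != 0.
  move=> j1 jp jq u0 hu hw gu gw xu xw; exists j.
  have [[r _ [_]]|[r -> [sr _]]] := A1_simplesP j; first by rewrite ltnNge j1.
  by move: sr; rewrite jp jq => sr; apply: standard_hom sr u0 hu hw gu gw xu xw.
have halve (u w : V) : u *+ 2 = w *+ 2 -> u = w.
  move=> e; apply/eqP; rewrite -subr_eq0; apply/eqP/(A1_mulrn_eq0 char0 (n := 1)).
  by rewrite mulrnBl e subrr.
have [[u [u0 xu Eu hu]]|[u [u0 seed_u hu]]] := simple_seed char0 v0.
  have du : d *: u = 0.
    by apply: (@A1_mulrn_eq0 _ char0 _ 2); rewrite scalerMnr -Eu actdE.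
  have gu : g *: u = h *: u.
    by apply: halve; rewrite actgg Eu du addr0 -scalerMnr mulrSr addrK.
  case: hu => hu.
    by apply: (of_char 1 ord0 u) => //; rewrite ?gu hu algs1.
  by apply: (of_char (-1) (inord 1) u); rewrite ?inordK ?expr1 ?gu ?hu ?algsN ?algs1.
have j2 : (2%:R * i) ^+ 2 = - 4%:R by rewrite exprMn i2 -natrX mulrN1.
have [w [c [w0 cE Ew xdw [xw hw]]]] := standard_eigenvector j2 u0 seed_u hu.
have n2 := natf_neq0_char0 char0 1; have n3 := natf_neq0_char0 char0 2.
have [eta [eta2 {}hw]] : exists eta : k, eta ^+ 2 = 1 /\ h *: w = eta%:A *: w.
  by case: hw => ->; [exists 1|exists (-1)]; rewrite ?sqrrN ?expr1n ?algsN algs1.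
(* On the span of w and d w, the action of h, g and x depends only on eta and c. *)
pose L a b := a%:A *: w + b%:A *: (d *: w).
have LD a b a' b' : L a b + L a' b' = L (a + a') (b + b').
  by rewrite /L !algsD addrACA.
have LZ e a b : e%:A *: L a b = L (e * a) (e * b) by rewrite /L scalerDr !algsA.
have LN a b : - L a b = L (- a) (- b) by rewrite /L !algsN opprD.
have L10 : w = L 1 0 by rewrite /L algs1 algs0 addr0.
have L01 : d *: w = L 0 1 by rewrite /L algs1 algs0 add0r.
have hL a b : h *: L a b = L (eta * a) (- (eta * b)).
  rewrite /L scalerDr !algsC hw algsA mulrC; congr (_ + _).
  by rewrite -[h *: _]opprK -actdh hw algsC scalerN algsA algsN mulrC.
have gw : g *: w = L (- eta / 2%:R) (1 / 2%:R).
  apply: halve; rewrite actgg Ew scaler0 add0r hw [X in - _ + X]L01 {1}L10.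
  by rewrite LZ LN LD mulr2n LD; congr (L _ _); field.
have gdw : g *: (d *: w) = L (3%:R / 2%:R) (eta / 2%:R).
  apply: halve; rewrite actgg actEd scaler0 add0r actdd Ew subr0 L01 hL LN.
  by rewrite -algs_nat {1}L10 LZ LD mulr2n LD; congr (L _ _); field.
have gL a b : g *: L a b
    = L ((b * 3%:R - a * eta) / 2%:R) ((a + b * eta) / 2%:R).
  by rewrite /L scalerDr !algsC gw gdw !LZ LD; congr (L _ _); field.
have xL a b : x *: L a b = L 0 (a * c / 3%:R).
  rewrite /L scalerDr !algsC xdw scaler0 addr0 algs0 add0r.
  rewrite -[x *: w]algs1 -(mulVf n3) -algsA algs_nat xw !algsA; congr (_%:A *: _).
  by field.
(* 1 + eta h doubles w and kills d w. *)
have L0 a b : L a b = 0 -> a = 0.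
  move=> e; have : L a b + eta%:A *: (h *: L a b) = 0 by rewrite e !scaler0 addr0.
  rewrite hL LZ LD mulrN !mulrA -expr2 eta2 !mul1r subrr /L algs0 addr0 -mulr2n.
  move=> e2; apply/eqP/negPn/negP => a0; case/negP: w0; apply/eqP.
  by apply: algsI e2; rewrite -mulr_natr mulf_neq0.
have eta_cases : eta = 1 \/ eta = -1.
  by move/eqP: eta2; rewrite sqrf_eq1 => /orP[]/eqP; [left|right].
case: eta_cases => etaE; rewrite {}etaE in hL gL {hw gw gdw}.
  (* For eta = 1 the canonical basis is 3 w + d w, 3 w - d w; comparing the actions of x gives c = 2
     th, so th = +-i. *)
  have main (j : 'I_6) th : (1 < j)%N -> simple_p j = th -> simple_q j = th ->
    c = th *+ 2 -> exists j (f : {linear S j -> V}) s, f s != 0.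
    move=> j1 jp jq ct.
    apply: (of_std j (L 3%:R 1) (L 3%:R (-1)) th th) => //;
      rewrite ?(hL, gL, xL) ?(LN, LZ) ?LD ?LN ?LD ?ct;
      try by congr (L _ _); field.
    by apply/eqP => /L0 e; case/eqP: n3.
  case: cE => cE; [apply: (main (inord 2) i)|apply: (main (inord 3) (- i))];
    rewrite ?inordK // cE; ring.
(* For eta = -1 the canonical basis is w + d w, - w + d w, and c = 6 th, so th = +-i/3. *)
have main (j : 'I_6) th : (1 < j)%N -> simple_p j = th -> simple_q j = - th ->
  c = th *+ 6 -> exists j (f : {linear S j -> V}) s, f s != 0.
  move=> j1 jp jq ct.
  apply: (of_std j (L 1 1) (L (-1) 1) th (- th)) => //;
    rewrite ?(hL, gL, xL) ?(LN, LZ) ?LD ?LN ?LD ?ct;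
    try by congr (L _ _); field.
  by apply/eqP => /L0 e; case/eqP: (oner_neq0 k).
case: cE => cE; [apply: (main (inord 4) (i / 3%:R))|apply: (main (inord 5) (- (i / 3%:R)))];
  by rewrite ?inordK ?opprK // cE; field.
Qed.

Lemma A1_complete_simples : complete_simples S.
Proof.
split; [exact: A1_simples_simple|exact: A1_simples_inj|exact: A1_simples_complete].
Qed.
End Classification.

(** * Extensions and cocycles *)

Lemma eq_mulmx_cV (R : pzRingType) m n (B C : 'M[R]_(m, n)) :
  (forall u : 'cV[R]_n, B *m u = C *m u) -> B = C.
Proof.
move=> BC; apply/matrixP => i j; have := congr1 (fun u : 'cV_m => u i 0) (BC (delta_mx j 0)).
by rewrite -!colE !mxE.
Qed.

Section Extensions.
Variable k : fieldType.
Hypothesis char0 : [pchar k] =i pred0.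
Local Notation A := (A1 k).
Variables (m n : nat) (r : A1_rep k m) (s : A1_rep k n).
Local Notation M := (rep_mod r).
Local Notation N := (rep_mod s).
Implicit Types X : transp -> 'M[k]_(n, m).

Definition cocycle X := A1_relations
  (fun t => block_mx (rep_H s t) 0 0 (rep_H r t))
  (fun j => block_mx (rep_a s j) (X j) 0 (rep_a r j)).

Definition equivariant (Y : 'M[k]_(n, m)) :=
  forall t, rep_H s t *m Y = Y *m rep_H r t.

(** Only S_3-equivariant sections are compared, and two of them differ by an equivariant Y. *)
Definition coboundary X := exists2 Y, equivariant Y &
  forall j, X j = rep_a s j *m Y - Y *m rep_a r j.

Definition semilinear (V : lmodType A) (f : M -> V) :=
  (forall u v, f (u + v) = f u + f v) /\ (forall c u, f (c%:A *: u) = c%:A *: f u).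

(** X measures how far the k-linear, S_3-equivariant sigma is from commuting with the a_j. *)
Definition twisted_section (V : lmodType A) (f : N -> V) X (sigma : M -> V) :=
  [/\ semilinear sigma, forall t u, A1_H k t *: sigma u = sigma (A1_H k t *: u)
    & forall j u, A1_a k j *: sigma u = sigma (A1_a k j *: u) + f (X j *m u)].

Lemma semilinear_lift (V : lmodType A) (f : {linear N -> V}) (phi : M -> V) :
  injective f -> semilinear phi -> (forall u, exists v, phi u = f v) ->
  exists Y : 'M[k]_(n, m), forall u, phi u = f (Y *m u).
Proof.
move=> inj_f [phiD phiC] phif; pose y u : 'cV[k]_n := projT1 (cid (phif u)).
have yE u : f (y u) = phi u by rewrite /y; case: cid.
pose z (v : 'rV[k]_m) : 'rV[k]_n := (y v^T)^T.
have lz : linear z.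
  move=> c u v; rewrite /z -linearP; congr (_^T); apply: inj_f.
  have -> : c *: y u^T + y v^T = (c%:A *: (y u^T : N) + (y v^T : N) : N).
    by rewrite rep_modC.
  rewrite yE; transitivity (phi (c%:A *: (u^T : M) + (v^T : M))).
    by rewrite rep_modC linearP.
  by rewrite phiD phiC [RHS]linearD linearZZ !yE.
have [Z ZE] := linear_of lz.
exists (lin1_mx Z)^T => u; rewrite -yE; congr (f _).
by rewrite -[RHS]trmxK trmx_mul trmxK mul_rV_lin1 ZE /z !trmxK.
Qed.

(** sigma - sigma' is given by an equivariant matrix Y. Equivalent extensions, Baer sums and
    multiples are all compared by pushing sections into one middle term and applying this. *)
Lemma twisted_section_diff (V : lmodType A) (f : {linear N -> V}) X X' sigma sigma' :
  injective f -> twisted_section f X sigma -> twisted_section f X' sigma' ->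
  (forall u, exists v, sigma u - sigma' u = f v) ->
  coboundary (fun j => X j - X' j).
Proof.
move=> inj_f [[sD sC] sH sa] [[s'D s'C] s'H s'a] ss'.
have [|Y YE] := semilinear_lift inj_f _ ss'.
  split=> [u v|c u]; first by rewrite sD s'D opprD addrACA.
  by rewrite sC s'C scalerBr.
exists Y => [t|j]; apply: eq_mulmx_cV => u; rewrite ?mulmxBl -!mulmxA; apply: inj_f.
  rewrite -[rep_H r t *m u]rep_modH -YE -[rep_H s t *m _]rep_modH linearZZ -YE.
  by rewrite scalerBr sH s'H.
rewrite [LHS]linearB [RHS]linearB -[rep_a r j *m u]rep_moda -YE.
rewrite -[rep_a s j *m _]rep_moda linearZZ -YE scalerBr sa s'a.
by rewrite (opprD (sigma' _)) addrACA [X in _ = X - _]addrC addrK.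
Qed.

Definition splits_with (E : extension M N) X :=
  exists2 sigma, twisted_section (ext_inj E) X sigma &
    forall u, ext_proj E (sigma u) = u.

Lemma semilinear_linear_comp (V W : lmodType A) (f : {linear V -> W}) (phi : M -> V) :
  semilinear phi -> semilinear (f \o phi).
Proof.
move=> [phiD phiC]; split=> [u v|c u] /=; first by rewrite phiD linearD.
by rewrite phiC linearZZ.
Qed.

Lemma semilinear_section (V : lmodType A) (p : {linear V -> M}) :
  (forall u, exists v, p v = u) ->
  exists2 phi : M -> V, semilinear phi & forall u, p (phi u) = u.
Proof.
move=> surj_p; pose e j := projT1 (cid (surj_p (delta_mx j 0))).
have eE j : p (e j) = delta_mx j 0 by rewrite /e; case: cid.
exists (fun u => \sum_j ((u : 'cV[k]_m) j 0)%:A *: e j).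
  split=> [u v|c u]; first by rewrite -big_split /=; apply: eq_bigr => j _; rewrite mxE algsD.
  rewrite rep_modC scaler_sumr; apply: eq_bigr => j _.
  by rewrite mxE algsA.
move=> u; rewrite linear_sum [RHS]matrix_sum_delta; apply: eq_bigr => j _.
by rewrite big_ord1 linearZZ eE rep_modC.
Qed.

(* Maschke: averaging over S_3 makes a section equivariant. *)
Lemma equivariant_section (V : lmodType A) (p : {linear V -> M}) :
  (forall u, exists v, p v = u) ->
  exists2 sigma : M -> V, semilinear sigma /\
    (forall t u, A1_H k t *: sigma u = sigma (A1_H k t *: u)) &
    forall u, p (sigma u) = u.
Proof.
move=> /semilinear_section[phi [phiD phiC] phiK].
pose c : k := #|{: 'S_3}|%:R^-1.
have c0 : #|{: 'S_3}|%:R != 0 :> k.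
  have /pcharf0P -> := char0; rewrite -lt0n; apply/card_gt0P.
  by exists 1%g.
exists (fun u => c%:A *: \sum_t A1_H k t^-1%g *: phi (A1_H k t *: u)).
  split; first split=> [u v|a u].
  - rewrite -scalerDr -big_split /=; congr (_ *: _); apply: eq_bigr => t _.
    by rewrite scalerDr phiD scalerDr.
  - rewrite -algsC; congr (_ *: _); rewrite scaler_sumr; apply: eq_bigr => t _.
    by rewrite algsC phiC algsC.
  - move=> t u; rewrite algsC; congr (_ *: _); rewrite scaler_sumr.
    rewrite (reindex_inj (mulgI t)) /=; apply: eq_bigr => w _.
    rewrite !scalerA !A1_HM; congr (A1_H k _ *: _).
    by rewrite invMg mulgKV.
move=> u; rewrite linearZZ linear_sum /=.
under eq_bigr => t _ do rewrite linearZZ phiK scalerA A1_HM mulgV A1_H1 scale1r.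
rewrite sumr_const -algs_nat algsA mulVf ?algs1 //.
Qed.

Lemma extension_splits (E : extension M N) : exists X, splits_with E X.
Proof.
have [sigma [[sD sC] sH] sK] := equivariant_section (@ext_projP _ _ _ E).
have lift j : exists Y : 'M[k]_(n, m), forall u,
    A1_a k j *: sigma u - sigma (A1_a k j *: u) = ext_inj E (Y *m u).
  apply: semilinear_lift; first exact: ext_injP.
    split=> [u v|c u]; first by rewrite sD !scalerDr sD opprD addrACA.
    by rewrite sC !algsC sC scalerBr.
  by move=> u; apply/ext_exact; rewrite linearB linearZZ !sK subrr.
exists (fun j => projT1 (cid (lift j))), sigma => //; split=> // j u.
by case: cid => Y /= <-; rewrite addrC subrK.
Qed.

(** [psi] embeds the block vectors in the middle term, and [reps B b] says that B acts there as b.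
    By injectivity every relation between elements of [A1] passes to the matrices. *)
Lemma splits_with_cocycle (E : extension M N) X : splits_with E X -> cocycle X.
Proof.
move=> [sigma [[sD sC] sH sa] sK].
pose psi (v : 'cV[k]_(n + m)) := ext_inj E (usubmx v : N) + sigma (dsubmx v : M).
have psi_inj : injective psi.
  move=> v w vw.
  have dvw : dsubmx v = dsubmx w.
    have /(congr1 (ext_proj E)) := vw; rewrite /psi !linearD !sK.
    have p0 z : ext_proj E (ext_inj E z) = 0 by apply/ext_exact; exists z.
    by rewrite !p0 !add0r.
  rewrite -[v]vsubmxK -[w]vsubmxK dvw; congr (col_mx _ _).
  by apply: (@ext_injP _ _ _ E); apply: (addIr (sigma (dsubmx v))); rewrite [LHS]vw /psi dvw.
pose reps (B : 'M[k]_(n + m)) (b : A) := forall v, psi (B *m v) = b *: psi v.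
have repsE B C b : reps B b -> reps C b -> B = C.
  by move=> hB hC; apply: eq_mulmx_cV => v; apply: psi_inj; rewrite hB hC.
have repsM B C b c : reps B b -> reps C c -> reps (B * C) (b * c).
  by move=> hB hC v; rewrite -mulmxE -mulmxA hB hC scalerA.
have psiD v w : psi (v + w) = psi v + psi w.
  by rewrite /psi linearD [ext_inj E _]linearD linearD sD addrACA.
have psiC c v : psi (c *: v) = c%:A *: psi v.
  by rewrite /psi !linearZ /= -!rep_modC linearZZ sC scalerDr.
have reps1 : reps 1 1 by move=> v; rewrite scale1r mul1mx.
have reps0 : reps 0 0 by move=> v; rewrite scale0r mul0mx -(scale0r v) psiC algs0.
have repsD B C b c : reps B b -> reps C c -> reps (B + C) (b + c).
  by move=> hB hC v; rewrite mulmxDl psiD hB hC scalerDl.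
have repsN B b : reps B b -> reps (- B) (- b).
  by move=> hB v; rewrite mulNmx -scaleN1r psiC hB algsN algs1 scaleNr.
have repsX (B : 'M[k]_(n + m)) b (e : bool) : reps B b -> reps ((-1) ^+ e * B) ((-1) ^+ e * b).
  by case: e => hB; rewrite ?expr1 ?expr0 ?mulN1r ?mul1r //; apply: repsN.
pose bH t := block_mx (rep_H s t) 0 0 (rep_H r t).
pose ba j := block_mx (rep_a s j) (X j) 0 (rep_a r j).
have repsH t : reps (bH t) (A1_H k t).
  move=> v; rewrite -{1}[v]vsubmxK mul_block_col !mul0mx add0r addr0.
  by rewrite /psi col_mxKu col_mxKd -!rep_modH linearZZ -sH scalerDr.
have repsa j : reps (ba j) (A1_a k j).
  move=> v; rewrite -{1}[v]vsubmxK mul_block_col !mul0mx add0r.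
  rewrite /psi col_mxKu col_mxKd -!rep_moda [ext_inj E _]linearD linearZZ scalerDr sa.
  by rewrite -addrA; congr (_ + _); rewrite addrC.
have [H1 HM Ha a2 aa] := A1_relationsP k.
split.
- by apply: repsE reps1; rewrite -A1_H1; apply: repsH.
- move=> t w; apply: (repsE _ _ _ _ (repsH (w * t)%g)).
  by rewrite -HM; apply: (repsM _ _ _ _ (repsH t) (repsH w)).
- move=> t j l e; apply: (repsE _ _ (A1_H k t * A1_a k j)).
    exact: (repsM _ _ _ _ (repsH t) (repsa j)).
  rewrite (Ha _ _ _ e) -!mulrA; apply: (repsX).
  exact: (repsM _ _ _ _ (repsa l) (repsH t)).
- apply: (repsE _ _ _ _ reps0); rewrite expr2 -(A1_xx k).
  exact: (repsM _ _ _ _ (repsa t12) (repsa t12)).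
- apply: (repsE _ _ (1 - A1_H k (val t12) * A1_H k (val t23))).
    rewrite -aa; apply: (repsD); first apply: (repsD).
    + exact: (repsM _ _ _ _ (repsa t12) (repsa t23)).
    + exact: (repsM _ _ _ _ (repsa t23) (repsa t13)).
    + exact: (repsM _ _ _ _ (repsa t13) (repsa t12)).
  apply: (repsD) => //; apply: (repsN).
  exact: (repsM _ _ _ _ (repsH (val t12)) (repsH (val t23))).
Qed.

Lemma cocycle_extension X : cocycle X -> exists E, splits_with E X.
Proof.
move=> cX; pose W := rep_mod (A1Rep cX).
have addW (u v : W) : u + v = (u : 'cV[k]_(n + m)) + (v : 'cV[k]_(n + m)) by [].
have [|||||f fE] := @A1_linear_of k N W (fun u => col_mx u 0).
- by move=> u v; rewrite addW add_col_mx addr0.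
- by move=> c u; rewrite !rep_modC scale_col_mx scaler0.
- by move=> u; rewrite !rep_modH mul_block_col !mulmx0 !mul0mx !addr0.
- by move=> u; rewrite !rep_modH mul_block_col !mulmx0 !mul0mx !addr0.
- by move=> u; rewrite !rep_moda mul_block_col !mulmx0 !mul0mx !addr0.
have [|||||p pE] := @A1_linear_of k W M (fun u => dsubmx (u : 'cV[k]_(n + m))).
- by move=> u v; rewrite linearD.
- by move=> c u; rewrite !rep_modC linearZ.
- by move=> u; rewrite !rep_modH -{1}[u]vsubmxK mul_block_col col_mxKd mul0mx add0r.
- by move=> u; rewrite !rep_modH -{1}[u]vsubmxK mul_block_col col_mxKd mul0mx add0r.
- by move=> u; rewrite !rep_moda -{1}[u]vsubmxK mul_block_col col_mxKd mul0mx add0r.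
have inj_f : injective f by move=> u v; rewrite !fE => /eq_col_mx[].
have surj_p u : exists v, p v = u by exists (col_mx 0 u); rewrite pE col_mxKd.
have fp v : p v = 0 <-> exists u, v = f u.
  rewrite pE; split=> [v0|[u ->]]; last by rewrite fE col_mxKd.
  by exists (usubmx v); rewrite fE -{1}[v]vsubmxK v0.
exists (Extension inj_f surj_p fp), (fun u => (col_mx 0 u : W)); last first.
  by move=> u /=; rewrite pE col_mxKd.
split; first split=> [u v|c u].
- by rewrite addW add_col_mx addr0.
- by rewrite !rep_modC scale_col_mx scaler0.
- by move=> t u; rewrite !rep_modH mul_block_col !mulmx0 !mul0mx !add0r.
- move=> j u /=; rewrite !rep_moda mul_block_col !mulmx0 !add0r fE.
  by rewrite addW add_col_mx add0r addr0.
Qed.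

Lemma ext_equiv_coboundary (E F : extension M N) X X' :
  splits_with E X -> splits_with F X' ->
  ext_equiv E F <-> coboundary (fun j => X j - X' j).
Proof.
move=> [sE [lE sEH sEa] sEK] [sF [lF sFH sFa] sFK]; split.
  move=> [u [uf up]].
  apply: (@twisted_section_diff _ (ext_inj F) _ _ (fun v => u (sE v)) sF).
  - exact: ext_injP.
  - split; first exact: semilinear_linear_comp.
      by move=> t v; rewrite -linearZZ sEH.
    by move=> j v; rewrite -linearZZ sEa linearD uf.
  - by [].
  - by move=> v; apply/ext_exact; rewrite linearB up sEK sFK subrr.
move=> [Y eqY XY].
have nP e : exists v, e - sE (ext_proj E e) = ext_inj E v.
  by apply/ext_exact; rewrite linearB sEK subrr.
(* The N-component of e relative to the section [sE]. *)
pose nu e := projT1 (cid (nP e)).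
have nuE e : ext_inj E (nu e) = e - sE (ext_proj E e) by rewrite /nu; case: cid.
(* Corrected by Y, the section of F has the same defect X as [sE]. *)
pose tau v : ext_mid F := sF v + ext_inj F (Y *m v).
have [tauD tauC] : semilinear tau.
  split=> [v w|c v]; rewrite /tau.
    by rewrite (lF.1) [_ *m _]mulmxDr [ext_inj F _]linearD addrACA.
  by rewrite (lF.2) scalerDr -linearZZ !rep_modC scalemxAr.
have tauH t v : A1_H k t *: tau v = tau (A1_H k t *: v).
  rewrite /tau scalerDr sFH -linearZZ; congr (_ + ext_inj F _).
  by rewrite !rep_modH !mulmxA eqY.
have taua j v : A1_a k j *: tau v = tau (A1_a k j *: v) + ext_inj F (X j *m v).
  rewrite /tau scalerDr sFa -linearZZ !rep_moda -!addrA; congr (_ + _).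
  rewrite -!linearD; congr (ext_inj F _).
  have -> : X j = X' j + (rep_a s j *m Y - Y *m rep_a r j) by rewrite -XY addrC subrK.
  rewrite mulmxDl mulmxBl !mulmxA.
  by rewrite [RHS]addrCA [X in _ = _ + X]addrC subrK.
have pf v : ext_proj E (ext_inj E v) = 0 by apply/ext_exact; exists v.
have nu_eq e v : e - sE (ext_proj E e) = ext_inj E v -> nu e = v.
  by rewrite -nuE; apply: ext_injP.
have [|||||u uE] := @A1_linear_of k (ext_mid E) (ext_mid F)
  (fun e => tau (ext_proj E e) + ext_inj F (nu e)).
- move=> e e'; have -> : nu (e + e') = nu e + nu e'.
    by apply: nu_eq; rewrite !linearD (lE.1) !nuE opprD addrACA.
  by rewrite [ext_proj E (e + e')]linearD tauD [ext_inj F (_ + _)]linearD addrACA.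
- move=> c e; have -> : nu (c%:A *: e) = c%:A *: nu e.
    by apply: nu_eq; rewrite !linearZZ (lE.2) nuE scalerBr.
  by rewrite !linearZZ tauC [RHS]scalerDr.
- move=> e; have -> : nu (A1_H k (val t12) *: e) = A1_H k (val t12) *: nu e.
    by apply: nu_eq; rewrite !linearZZ -sEH nuE scalerBr.
  by rewrite !linearZZ -tauH [RHS]scalerDr.
- move=> e; have -> : nu (A1_H k (val t23) *: e) = A1_H k (val t23) *: nu e.
    by apply: nu_eq; rewrite !linearZZ -sEH nuE scalerBr.
  by rewrite !linearZZ -tauH [RHS]scalerDr.
- move=> e; have -> : nu (A1_a k t12 *: e) = A1_a k t12 *: nu e + (X t12 *m ext_proj E e).
    apply: nu_eq; rewrite linearZZ linearD linearZZ nuE scalerBr sEa.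
    by rewrite opprD addrA subrK.
  by rewrite linearZZ [RHS]scalerDr taua linearD linearZZ addrA addrAC.
exists u; split=> [v|e].
  rewrite uE pf; have -> : nu (ext_inj E v) = v.
    apply: nu_eq; rewrite pf -[X in sE X](scale0r (0 : M)) -[0 : A](scale0r 1).
    by rewrite (lE.2) !scale0r subr0.
  by rewrite -[X in tau X](scale0r (0 : M)) -[0 : A](scale0r 1) tauC !scale0r add0r.
have pf' v : ext_proj F (ext_inj F v) = 0 by apply/ext_exact; exists v.
by rewrite uE /tau !linearD sFK !pf' !addr0.
Qed.

(** Inside the extension of M * M, the images of [sG] and of the pair ([sE], [sF]) both lie over the
    diagonal, with defects X'' and X + X'. *)
Lemma baer_sum_coboundary (E F G : extension M N) X X' X'' :
  splits_with E X -> splits_with F X' -> splits_with G X'' -> baer_sum E F G ->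
  coboundary (fun j => X'' j - (X j + X' j)).
Proof.
move=> [sE [lE sEH sEa] sEK] [sF [lF sFH sFa] sFK] [sG [lG sGH sGa] sGK].
move=> [Z [[w [wf wp]] [v [vf vp]]]].
apply: (@twisted_section_diff _ (ext_inj Z) _ _ (fun u => v (sG u))
  (fun u => w (sE u, sF u))).
- exact: ext_injP.
- split; first exact: semilinear_linear_comp.
    by move=> t u; rewrite -linearZZ sGH.
  by move=> j u; rewrite -linearZZ sGa linearD vf.
- split; first split=> [u u'|c u].
  + by rewrite (lE.1) (lF.1) -linearD.
  + by rewrite (lE.2) (lF.2) -linearZZ.
  + by move=> t u; rewrite -linearZZ -sEH -sFH.
  + move=> j u; rewrite -linearZZ mulmxDl.
    rewrite -(wf (X j *m u, X' j *m u)) -linearD; congr (w _).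
    exact: (congr2 pair (sEa j u) (sFa j u)).
- move=> u; apply/ext_exact; rewrite linearB vp wp /= /dsum_proj /= sGK sEK sFK.
  by rewrite subrr.
Qed.

Lemma ext_scale_coboundary (E G : extension M N) X X' c :
  splits_with E X -> splits_with G X' -> ext_scale c E G ->
  coboundary (fun j => X' j - c *: X j).
Proof.
move=> [sE [lE sEH sEa] sEK] [sG [lG sGH sGa] sGK] [u [uf up]].
apply: (@twisted_section_diff _ (ext_inj G) _ _ sG (fun v => u (sE v))) => //.
- exact: ext_injP.
- split; first exact: semilinear_linear_comp.
    by move=> t v; rewrite -linearZZ sEH.
  by move=> j v; rewrite -linearZZ sEa linearD uf rep_modC scalemxAl.
- by move=> v; apply/ext_exact; rewrite linearB up sEK sGK subrr.
Qed.

(** L is a coordinate system on cocycles modulo coboundaries; an extension is sent to the value of L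
    on a chosen cocycle. *)
Lemma dim_Ext1_functional e (L : (transp -> 'M[k]_(n, m)) -> 'rV[k]_e) :
  (forall X X', L (fun j => X j + X' j) = L X + L X') ->
  (forall c X, L (fun j => c *: X j) = c *: L X) ->
  (forall X, coboundary X -> L X = 0) ->
  (forall X X', cocycle X -> cocycle X' -> L X = L X' -> coboundary (fun j => X j - X' j)) ->
  (forall v, exists2 X, cocycle X & L X = v) ->
  dim_Ext1 M N e.
Proof.
move=> LD LZ L0 Linj Lsurj.
have LB X X' : L (fun j => X j - X' j) = L X - L X'.
  have := LD X (fun j => -1 *: X' j); rewrite LZ scaleN1r => <-; congr (L _).
  by apply/funext => j; rewrite scaleN1r.
pose X_ E := projT1 (cid (extension_splits E)).
have XP E : splits_with E (X_ E) by rewrite /X_; case: cid.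
exists (fun E => L (X_ E)); split=> [E F|v|E F G EFG|c E G EG].
- split=> [LEF|/(ext_equiv_coboundary (XP E) (XP F))/L0].
    apply/(ext_equiv_coboundary (XP E) (XP F)).
    by apply: Linj LEF; apply: splits_with_cocycle (XP _).
  by rewrite LB => /eqP; rewrite subr_eq0 => /eqP.
- have [X cX <-] := Lsurj v; have [E EX] := cocycle_extension cX.
  exists E; apply/eqP; rewrite -subr_eq0 -LB; apply/eqP/L0.
  apply/(ext_equiv_coboundary (XP E) EX).
  by exists idfun.
- have /L0 := baer_sum_coboundary (XP E) (XP F) (XP G) EFG.
  by rewrite LB LD => /eqP; rewrite subr_eq0 => /eqP.
- have /L0 := ext_scale_coboundary (XP E) (XP G) EG.
  by rewrite LB LZ => /eqP; rewrite subr_eq0 => /eqP.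
Qed.
End Extensions.

(** * Cocycles determined by a_12 *)

Section Cocycles.
Variable k : fieldType.
Hypothesis char0 : [pchar k] =i pred0.
Variables (m n : nat) (r : A1_rep k m) (s : A1_rep k n).
Implicit Types Z Y : 'M[k]_(n, m).

Definition conj_family Z (j : transp) : 'M[k]_(n, m) :=
  if j == t12 then Z
  else if j == t13 then - (rep_H s (val t23) *m Z *m rep_H r (val t23))
  else - (rep_H s (val t13) *m Z *m rep_H r (val t13)).

Lemma conj_family12 Z : conj_family Z t12 = Z.
Proof. by rewrite /conj_family eqxx. Qed.
Lemma conj_family13 Z :
  conj_family Z t13 = - (rep_H s (val t23) *m Z *m rep_H r (val t23)).
Proof. by rewrite /conj_family t13_neq12 eqxx. Qed.
Lemma conj_family23 Z :
  conj_family Z t23 = - (rep_H s (val t13) *m Z *m rep_H r (val t13)).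
Proof. by rewrite /conj_family t23_neq12 t23_neq13. Qed.

(** The derivative of a_12 a_23 + a_23 a_13 + a_13 a_12 in the direction Z, that is, its
    off-diagonal block; 1 - H_12 H_23 is block diagonal. *)
Definition quadratic_part Z :=
  (rep_a s t12 *m conj_family Z t23 + Z *m rep_a r t23)
  + (rep_a s t23 *m conj_family Z t13 + conj_family Z t23 *m rep_a r t13)
  + (rep_a s t13 *m Z + conj_family Z t13 *m rep_a r t12).

Definition cocycle_mx Z :=
  [/\ rep_H s (val t12) *m Z = - (Z *m rep_H r (val t12)),
      rep_a s t12 *m Z + Z *m rep_a r t12 = 0 & quadratic_part Z = 0].

Lemma cocycleP (X : transp -> 'M[k]_(n, m)) :
  cocycle r s X <-> X =1 conj_family (X t12) /\ cocycle_mx (X t12).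
Proof.
have [rh r13 r23] := A1_relations_conj (rep_rel r).
have [sh s13 s23] := A1_relations_conj (rep_rel s).
have [rH1 rHM _ rx raa] := rep_rel r; have [sH1 sHM _ sx saa] := rep_rel s.
rewrite expr2 in rx; rewrite expr2 in sx.
rewrite -!mulmxE in rx sx rh sh r13 r23 s13 s23 raa saa.
have one_block : (1 : 'M[k]_(n + m)) = block_mx 1%:M 0 0 1%:M by rewrite -scalar_mx_block.
split=> [cX|[XE [c1 c2 c3]]].
  have [bh b13 b23] := A1_relations_conj cX; have [_ _ _ bx baa] := cX.
  rewrite expr2 in bx; rewrite -!mulmxE in bh b13 b23 bx baa.
  rewrite !mulmx_block !(mul0mx, mulmx0, addr0, add0r) in bh b13 b23 bx baa.
  have {}XE : X =1 conj_family (X t12).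
    move=> j; case: (transpP j) => ->; first by rewrite conj_family12.
      by have := congr1 ursubmx b13; rewrite conj_family13 opp_block_mx !block_mxKur.
    by have := congr1 ursubmx b23; rewrite conj_family23 opp_block_mx !block_mxKur.
  split=> //; split.
  - by have := congr1 ursubmx bh; rewrite opp_block_mx !block_mxKur.
  - by have := congr1 ursubmx bx; rewrite -[0 in RHS]block_mx0 !block_mxKur.
  - rewrite /quadratic_part -!XE; have := congr1 ursubmx baa.
    by rewrite one_block opp_block_mx !add_block_mx !block_mxKur subrr.
apply: A1_relations_intro; rewrite -?mulmxE.
- by rewrite rH1 sH1 one_block.
- move=> t w; rewrite mulmx_block !(mul0mx, mulmx0, addr0, add0r).
  by rewrite -rHM -sHM.
- rewrite !mulmx_block opp_block_mx !(mul0mx, mulmx0, addr0, add0r) oppr0.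
  by rewrite rh sh c1.
- rewrite !mulmx_block opp_block_mx !(mul0mx, mulmx0, addr0, add0r) oppr0.
  by rewrite XE r13 s13 conj_family13.
- rewrite !mulmx_block opp_block_mx !(mul0mx, mulmx0, addr0, add0r) oppr0.
  by rewrite XE r23 s23 conj_family23.
- rewrite !mulmx_block !(mul0mx, mulmx0, addr0, add0r) rx sx c2.
  by rewrite block_mx0.
- rewrite !mulmx_block !(mul0mx, mulmx0, addr0, add0r) one_block opp_block_mx.
  rewrite !add_block_mx !(addr0, oppr0) raa saa; congr (block_mx _ _ _ _).
  by rewrite (XE t13) (XE t23) -[RHS]c3.
Qed.

Lemma coboundary_conj_family Y : equivariant r s Y ->
  coboundary r s (conj_family (rep_a s t12 *m Y - Y *m rep_a r t12)).
Proof.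
have [_ r13 r23] := A1_relations_conj (rep_rel r).
have [_ s13 s23] := A1_relations_conj (rep_rel s).
rewrite -!mulmxE in r13 r23 s13 s23.
move=> eY; exists Y => // j; case: (transpP j) => ->.
- by rewrite conj_family12.
- rewrite conj_family13 r13 s13 mulmxBr mulmxBl mulNmx mulmxN opprB opprK addrC.
  by rewrite !mulmxA eY -!mulmxA eY.
- rewrite conj_family23 r23 s23 mulmxBr mulmxBl mulNmx mulmxN opprB opprK addrC.
  by rewrite !mulmxA eY -!mulmxA eY.
Qed.

Lemma conj_family_linear j : linear (conj_family^~ j).
Proof.
move=> c Z Z'; case: (transpP j) => ->.
- by rewrite !conj_family12.
- by rewrite !conj_family13 mulmxDr mulmxDl -scalemxAr -scalemxAl opprD scalerN.
- by rewrite !conj_family23 mulmxDr mulmxDl -scalemxAr -scalemxAl opprD scalerN.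
Qed.

Lemma quadratic_part_linear : linear quadratic_part.
Proof.
move=> c Z Z'; rewrite /quadratic_part !conj_family_linear.
have key (a a' b b' : 'M[k]_(n, m)) :
    (c *: a + a') + (c *: b + b') = c *: (a + b) + (a' + b').
  by rewrite scalerDr addrACA.
by rewrite !(mulmxDr, mulmxDl) -!scalemxAr -!scalemxAl !key.
Qed.

Lemma cocycle_mx0 : cocycle_mx 0.
Proof.
split; rewrite ?mulmx0 ?mul0mx ?oppr0 ?addr0 //.
(* Linearity with coefficient -1 reads q = - q + q for q = [quadratic_part 0]. *)
have := quadratic_part_linear (-1) 0 0.
by rewrite scaler0 addr0 scaleN1r addNr.
Qed.

Lemma cocycle_mx_linear c Z Z' : cocycle_mx Z -> cocycle_mx Z' -> cocycle_mx (c *: Z + Z').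
Proof.
move=> [e1 e2 e3] [f1 f2 f3]; split.
- by rewrite mulmxDr mulmxDl -scalemxAr -scalemxAl e1 f1 opprD scalerN.
- rewrite mulmxDr mulmxDl -scalemxAr -scalemxAl addrACA -scalerDr e2 f2.
  by rewrite scaler0 addr0.
- by rewrite quadratic_part_linear e3 f3 scaler0 addr0.
Qed.

Lemma coboundary_sub X X' : coboundary r s X -> coboundary r s X' ->
  coboundary r s (fun j => X j - X' j).
Proof.
move=> [Y eY XY] [Y' eY' XY']; exists (Y - Y') => [t|j].
  by rewrite mulmxBr mulmxBl eY eY'.
rewrite XY XY' mulmxBr mulmxBl !opprB.
by rewrite [_ - rep_a s j *m Y']addrC addrACA [- (Y *m _) + _]addrC.
Qed.

Lemma dim_Ext1_0 :
  (forall Z, cocycle_mx Z ->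
     exists2 Y, equivariant r s Y & Z = rep_a s t12 *m Y - Y *m rep_a r t12) ->
  dim_Ext1 (rep_mod r) (rep_mod s) 0.
Proof.
move=> trivZ; apply: (dim_Ext1_functional char0 (L := fun=> 0)) => //.
- by move=> *; rewrite addr0.
- by move=> *; rewrite scaler0.
- have cob X : cocycle r s X -> coboundary r s X.
    move=> /cocycleP[XE /trivZ[Y eY YE]]; have [W eW WE] := coboundary_conj_family eY.
    by exists W => // j; rewrite XE YE.
  by move=> X X' /cob cX /cob cX' _; apply: coboundary_sub.
- move=> v; exists (conj_family 0); last by rewrite [v]thinmx0.
  by apply/cocycleP; rewrite conj_family12; split=> //; apply: cocycle_mx0.
Qed.

(** Without equivariant maps all coboundaries vanish, so the entry (a, b) of Z is a coordinate on
    Ext. *)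
Lemma dim_Ext1_1 (Z1 : 'M[k]_(n, m)) a b :
  (forall Y, equivariant r s Y -> Y = 0) ->
  (forall Z, cocycle_mx Z -> Z a b = 0 -> Z = 0) ->
  cocycle_mx Z1 -> Z1 a b = 1 ->
  dim_Ext1 (rep_mod r) (rep_mod s) 1.
Proof.
move=> eq0 inj_ab cZ1 Z1ab.
apply: (dim_Ext1_functional char0 (L := fun X => (X t12 a b)%:M)) => //.
- by move=> X X'; rewrite mxE raddfD.
- by move=> c X; rewrite mxE scale_scalar_mx.
- by move=> X [Y /eq0-> ->]; rewrite mulmx0 mul0mx subr0 mxE raddf0.
- move=> X X' /cocycleP[XE cX] /cocycleP[X'E cX'] /(congr1 (fun u : 'rV[k]_1 => u 0 0)).
  rewrite !mxE eqxx !mulr1n => e.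
  have XX' : X t12 = X' t12.
    apply/eqP; rewrite -subr_eq0 addrC -scaleN1r; apply/eqP/inj_ab.
      exact: cocycle_mx_linear.
    by rewrite !mxE e mulN1r addNr.
  exists 0 => [t|j]; first by rewrite mulmx0 mul0mx.
  by rewrite XE X'E XX' subrr mulmx0 mul0mx subr0.
- move=> v; exists (conj_family (v 0 0 *: Z1)).
    apply/cocycleP; rewrite conj_family12; split=> //.
    by rewrite -[_ *: _]addr0; apply: cocycle_mx_linear => //; apply: cocycle_mx0.
  by rewrite conj_family12 mxE Z1ab mulr1 -mx11_scalar.
Qed.
End Cocycles.

(** * Dimensions of the Ext spaces *)

Section RowPairs.
Variable k : fieldType.

Definition rv2 (a b : k) : 'rV[k]_2 := \row_i (if i == 0 then a else b).

Lemma rv2P (u : 'rV[k]_2) : u = rv2 (u 0 0) (u 0 1).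
Proof.
apply/rowP => i; rewrite mxE; case: i => -[|[|[|//]]] lt_i /=;
  by congr (u _ _); apply: val_inj.
Qed.

Lemma rv2_mx2 a b c e a' b' :
  rv2 a' b' *m mx2 a b c e = rv2 (a' * a + b' * c) (a' * b + b' * e).
Proof.
by rewrite [LHS]rv2P; congr (rv2 _ _); rewrite mxE !big_ord_recl big_ord0 !mxE addr0.
Qed.

Lemma rv2D a b a' b' : rv2 a b + rv2 a' b' = rv2 (a + a') (b + b').
Proof. by rewrite [LHS]rv2P !mxE. Qed.
Lemma rv2N a b : - rv2 a b = rv2 (- a) (- b).
Proof. by rewrite [LHS]rv2P !mxE. Qed.
Lemma rv2Z c a b : c *: rv2 a b = rv2 (c * a) (c * b).
Proof. by rewrite [LHS]rv2P !mxE. Qed.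
Lemma rv2_0 : 0 = rv2 0 0.
Proof. by rewrite [LHS]rv2P !mxE. Qed.
Lemma cv2_0 : 0 = cv2 0 0 :> 'cV[k]_2.
Proof. by rewrite [LHS]cv2P !mxE. Qed.
Lemma rv2_inj a b a' b' : rv2 a b = rv2 a' b' -> a = a' /\ b = b'.
Proof.
move=> e; have := congr1 (fun u : 'rV[k]_2 => u 0 0) e.
by have := congr1 (fun u : 'rV[k]_2 => u 0 1) e; rewrite !mxE /= => -> ->.
Qed.
Lemma cv2_inj a b a' b' : cv2 a b = cv2 a' b' :> 'cV[k]_2 -> a = a' /\ b = b'.
Proof.
move=> e; have := congr1 (fun u : 'cV[k]_2 => u 0 0) e.
by have := congr1 (fun u : 'cV[k]_2 => u 1 0) e; rewrite !mxE /= => -> ->.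
Qed.
Lemma mx2_inj a b c e a' b' c' e' : mx2 a b c e = mx2 a' b' c' e' :> 'M[k]_2 ->
  [/\ a = a', b = b', c = c' & e = e'].
Proof.
move=> eq; have := congr1 (fun u : 'M[k]_2 => u 0 0) eq.
have := congr1 (fun u : 'M[k]_2 => u 0 1) eq.
have := congr1 (fun u : 'M[k]_2 => u 1 0) eq.
by have := congr1 (fun u : 'M[k]_2 => u 1 1) eq; rewrite !mxE /= => -> -> -> ->.
Qed.
End RowPairs.

Section ExtDimensions.
Variable k : fieldType.
Hypothesis char0 : [pchar k] =i pred0.

Lemma character_matrices (r : A1_rep k 1) eta : is_character r eta ->
  [/\ rep_H r (val t13) = eta%:M, rep_a r t13 = 0, rep_a r t23 = 0 & eta * eta = 1].
Proof.
move=> cr; have [rh rg rx] := cr; have [_ -> ->] := A1_relations_conj (rep_rel r).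
have eta2 := char_eta2 cr; have [_ HM _ _ _] := rep_rel r.
rewrite rx !(mulr0, mul0r) oppr0; split=> //.
by rewrite t13_conj -!HM rh rg -!mulmxE -!scalar_mxM eta2 mulr1.
Qed.

Lemma standard_matrices (r : A1_rep k 2) p q : is_standard r p q ->
  [/\ rep_a r t12 = mx2 p q (- q) (- p),
      rep_a r t13 = mx2 (q - p) q (p *+ 2 - q *+ 2) (p - q) &
      rep_a r t23 = mx2 (q - p) (q *+ 2 - p *+ 2) (- q) (p - q)].
Proof.
move=> [rH rx]; have [_ -> ->] := A1_relations_conj (rep_rel r).
rewrite !rH rx st_H13 st_H23 !mx2M !mx2N.
by split=> //; apply: mx2_congr; ring.
Qed.

(** Converse of [st_rel], read off from one entry of x^2 = 0 and one of the quadratic relation. *)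
Lemma standard_params (r : A1_rep k 2) p q : is_standard r p q ->
  p ^+ 2 = q ^+ 2 /\ p ^+ 2 *+ 5 - p * q *+ 4 = -1.
Proof.
move=> sr; have [r12 r13 r23] := standard_matrices sr; have [rH _] := sr.
have [_ _ _ rx raa] := rep_rel r; have nz := natf_neq0_char0 char0.
have pq : p ^+ 2 = q ^+ 2.
  move: rx; rewrite expr2 r12 mx2M mx2_0 => /mx2_inj[e _ _ _].
  by apply/eqP; rewrite -subr_eq0 -e; apply/eqP; ring.
split=> //; move: raa; rewrite r12 r13 r23 !rH st_H12 st_H23 mx2_1 !mx2M !mx2D mx2N mx2D.
move=> /mx2_inj[e _ _ _]; apply/eqP; rewrite -subr_eq0; apply/eqP.
have {}e : p * q *+ 8 - p ^+ 2 *+ 5 - q ^+ 2 *+ 5 - 2%:R = 0.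
  by move/eqP: e; rewrite -subr_eq0 => /eqP <-; ring.
apply: (mulfI (nz 1)); rewrite mulr0 -oppr0 -e -pq; ring.
Qed.

Lemma double_sign_neq0 (eta : k) : eta * eta = 1 -> eta + eta != 0.
Proof.
move=> eta2; rewrite -mulr2n -mulr_natr mulf_neq0 ?natf_neq0_char0 //.
by apply: contra_eq_neq eta2 => ->; rewrite mul0r eq_sym oner_neq0.
Qed.

Section CharacterCharacter.
Variables (r s : A1_rep k 1) (eta eta' : k).
Hypotheses (cr : is_character r eta) (cs : is_character s eta').

Lemma dim_Ext1_character_same : eta = eta' -> dim_Ext1 (rep_mod r) (rep_mod s) 0.
Proof.
move=> e; apply: (dim_Ext1_0 char0) => Z [c1 _ _]; exists 0.
  by move=> t; rewrite mulmx0 mul0mx.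
rewrite mulmx0 mul0mx subr0; have [_ _ _ eta2] := character_matrices cr.
move: c1; have [-> _ _] := cr; have [-> _ _] := cs.
rewrite mul_scalar_mx mul_mx_scalar -e => /eqP; rewrite -addr_eq0 -scalerDl scaler_eq0.
by rewrite (negPf (double_sign_neq0 eta2)) => /eqP.
Qed.

(** For opposite signs anticommutation with H_12 is automatic, and all a_j act by 0, so every 1 x 1
    block is a cocycle: the arrows 1 -> 2 and 2 -> 1. *)
Lemma dim_Ext1_character_diff : eta' = - eta -> dim_Ext1 (rep_mod r) (rep_mod s) 1.
Proof.
move=> e; have [r13 ra13 ra23 eta2] := character_matrices cr.
have [s13 sa13 sa23 _] := character_matrices cs.
have [rh rg rx] := cr; have [sh sg sx] := cs.
apply: (dim_Ext1_1 char0 (Z1 := 1%:M) (a := 0) (b := 0)).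
- move=> Y /(_ (val t12)); rewrite rh sh mul_scalar_mx mul_mx_scalar e => /eqP.
  rewrite scaleNr eq_sym -addr_eq0 -scalerDl scaler_eq0.
  by rewrite (negPf (double_sign_neq0 eta2)) => /eqP.
- by move=> Z _ Z0; apply/matrixP => a b; rewrite !ord1 Z0 mxE.
- split.
  + by rewrite rh sh e mulmx1 mul1mx raddfN.
  + by rewrite rx sx mulmx0 mul0mx addr0.
  + rewrite /quadratic_part rx sx ra13 sa13 ra23 sa23.
    by rewrite !(mulmx0, mul0mx, addr0).
- by rewrite mxE.
Qed.
End CharacterCharacter.

Section CharacterStandard.
Variables (r : A1_rep k 1) (s : A1_rep k 2) (eta p q : k).
Hypotheses (cr : is_character r eta) (ss : is_standard s p q).

(** Anticommutation makes Z the column (a, - eta a), and x Z = 0 becomes (p - eta q) a = 0. *)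
Lemma dim_Ext1_character_standard_0 : p != eta * q ->
  dim_Ext1 (rep_mod r) (rep_mod s) 0.
Proof.
move=> pq; apply: (dim_Ext1_0 char0) => Z [c1 c2 _]; exists 0.
  by move=> t; rewrite mulmx0 mul0mx.
rewrite mulmx0 mul0mx subr0.
have [rh _ rx] := cr; have [sH sx] := ss.
move: c1 c2; rewrite rh rx sx sH st_H12 mulmx0 addr0 mul_mx_scalar [Z]cv2P.
set a := Z 0 0; set b := Z 1 0.
rewrite !mx2_cv2 cv2Z cv2N cv2_0 => /cv2_inj[b_eq _] /cv2_inj[ab _].
rewrite mul0r add0r mul1r in b_eq.
have a0 : a = 0.
  apply/eqP; have : (p - eta * q) * a == 0.
    by rewrite -ab b_eq; apply/eqP; ring.
  by rewrite mulf_eq0 subr_eq0 (negPf pq).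
by rewrite b_eq a0 mulr0 oppr0.
Qed.

(** Source of 1 -> 3, 1 -> 4 (eta = 1, p = q) and of 2 -> 5, 2 -> 6 (eta = -1, p = - q). *)
Lemma dim_Ext1_character_standard_1 : p = eta * q ->
  dim_Ext1 (rep_mod r) (rep_mod s) 1.
Proof.
move=> pq; have [r13 ra13 ra23 eta2] := character_matrices cr.
have [rh rg rx] := cr; have [sH _] := ss; have [sx s13 s23] := standard_matrices ss.
have n3 := natf_neq0_char0 char0 2.
apply: (dim_Ext1_1 char0 (Z1 := cv2 1 (- eta)) (a := 0) (b := 0)).
- move=> Y eY; have := eY (val t12); have := eY (val t23); move: eY => _.
  rewrite rh rg !sH st_H12 st_H23 !mul_mx_scalar [Y]cv2P !mx2_cv2 !cv2Z.
  set a := Y 0 0; set b := Y 1 0 => /cv2_inj[e1 e2] /cv2_inj[e3 e4].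
  rewrite ?(mul0r, mul1r, mulN1r, add0r, addr0) in e1 e2 e3 e4.
  have ba : b = a by rewrite e3 -e1.
  have e : - a - a = a by rewrite -{2}ba e2 -e4.
  have a0 : a = 0.
    apply: (mulfI n3); rewrite mulr0; transitivity (a - (- a - a)); first by ring.
    by rewrite e subrr.
  by rewrite ba a0 -cv2_0.
- move=> Z [c1 _ _] Z0; move: c1; rewrite rh sH st_H12 mul_mx_scalar [Z]cv2P Z0.
  rewrite mx2_cv2 cv2Z cv2N => /cv2_inj[e _]; rewrite ?(mul0r, mul1r, mulr0, add0r, oppr0) in e.
  by rewrite e -cv2_0.
- split.
  + by rewrite rh sH st_H12 mul_mx_scalar mx2_cv2 cv2Z cv2N; congr (cv2 _ _); ring: eta2.
  + rewrite rx sx mulmx0 addr0 mx2_cv2 cv2_0 pq; congr (cv2 _ _); ring: eta2.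
  + rewrite /quadratic_part conj_family13 conj_family23 rx ra13 ra23 sx s13 s23.
    rewrite rg r13 !sH st_H13 st_H23 !mulmx0 !addr0 !mul_mx_scalar !mx2_cv2 !cv2Z !cv2N.
    rewrite !mx2_cv2 !cv2D cv2_0 pq; congr (cv2 _ _); ring: eta2.
- by rewrite mxE.
Qed.
End CharacterStandard.

Section StandardCharacter.
Variables (r : A1_rep k 2) (s : A1_rep k 1) (eta p q : k).
Hypotheses (sr : is_standard r p q) (cs : is_character s eta).

Lemma dim_Ext1_standard_character_0 : p != - (eta * q) ->
  dim_Ext1 (rep_mod r) (rep_mod s) 0.
Proof.
move=> pq; apply: (dim_Ext1_0 char0) => Z [c1 c2 _]; exists 0.
  by move=> t; rewrite mulmx0 mul0mx.
rewrite mulmx0 mul0mx subr0.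
have [sh _ sx] := cs; have [rH rx] := sr.
move: c1 c2; rewrite sh rx sx rH st_H12 mul0mx add0r mul_scalar_mx [Z]rv2P.
set a := Z 0 0; set b := Z 0 1.
rewrite !rv2_mx2 rv2Z rv2N rv2_0 => /rv2_inj[b_eq _] /rv2_inj[ab _].
rewrite ?(mulr0, mulr1, add0r) in b_eq.
have bE : b = - (eta * a) by rewrite b_eq opprK.
have a0 : a = 0.
  apply/eqP; have : (p + eta * q) * a == 0.
    by rewrite -ab bE; apply/eqP; ring.
  by rewrite mulf_eq0 addr_eq0 (negPf pq).
by rewrite bE a0 mulr0 oppr0.
Qed.

(** Source of 3 -> 2, 4 -> 2 (eta = -1, p = q) and of 5 -> 1, 6 -> 1 (eta = 1, p = - q). *)
Lemma dim_Ext1_standard_character_1 : p = - (eta * q) ->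
  dim_Ext1 (rep_mod r) (rep_mod s) 1.
Proof.
move=> pq; have [sh13 sa13 sa23 eta2] := character_matrices cs.
have [sh sg sx] := cs; have [rH _] := sr; have [rx r13 r23] := standard_matrices sr.
have n3 := natf_neq0_char0 char0 2.
apply: (dim_Ext1_1 char0 (Z1 := rv2 1 (- eta)) (a := 0) (b := 0)).
- move=> Y eY; have := eY (val t12); have := eY (val t23); move: eY => _.
  rewrite sh sg !rH st_H12 st_H23 !mul_scalar_mx [Y]rv2P !rv2_mx2 !rv2Z.
  set a := Y 0 0; set b := Y 0 1 => /rv2_inj[e1 e2] /rv2_inj[e3 e4].
  rewrite ?(mulr0, mulr1, mulrN1, add0r, addr0) in e1 e2 e3 e4.
  have ab : a = - b by rewrite -e4 e2.
  have e : b = - b - b by rewrite -{1}e3 e1 {1}ab.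
  have b0 : b = 0.
    apply: (mulfI n3); rewrite mulr0; transitivity (b - (- b - b)); first by ring.
    by rewrite -e subrr.
  by rewrite ab b0 oppr0 -rv2_0.
- move=> Z [c1 _ _] Z0; move: c1; rewrite sh rH st_H12 mul_scalar_mx [Z]rv2P Z0.
  rewrite rv2_mx2 rv2Z rv2N => /rv2_inj[e _].
  rewrite ?(mul0r, mulr1, mulr0, add0r) in e.
  by rewrite -[Z 0 1]opprK -e oppr0 -rv2_0.
- split.
  + by rewrite sh rH st_H12 mul_scalar_mx rv2_mx2 rv2Z rv2N; congr (rv2 _ _); ring: eta2.
  + rewrite rx sx mul0mx add0r rv2_mx2 rv2_0 pq; congr (rv2 _ _); ring: eta2.
  + rewrite /quadratic_part conj_family13 conj_family23 sx sa13 sa23 rx r13 r23.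
    rewrite sg sh13 !rH st_H13 st_H23 !mul0mx !add0r !mul_scalar_mx !rv2Z !rv2_mx2 !rv2N.
    rewrite !rv2_mx2 !rv2D rv2_0 pq; congr (rv2 _ _); ring: eta2.
- by rewrite mxE.
Qed.
End StandardCharacter.

End ExtDimensions.

Section ExtDimensions.
Variable k : fieldType.
Hypothesis char0 : [pchar k] =i pred0.

Section StandardStandard.
Variables (r s : A1_rep k 2) (p q p' q' : k).
Hypotheses (sr : is_standard r p' q') (ss : is_standard s p q).

(** For p <> p' the block is the coboundary of a scalar Y. For equal parameters (x, y) is a tangent
    vector at (p, q) to the system p^2 = q^2, 5 p^2 - 4 p q = -1, whose solutions are simple, so it
    vanishes. *)
Lemma dim_Ext1_standard_standard : dim_Ext1 (rep_mod r) (rep_mod s) 0.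
Proof.
have [pq e5] := standard_params char0 ss; have [pq' e5'] := standard_params char0 sr.
have [rH _] := sr; have [rx r13 r23] := standard_matrices sr.
have [sH _] := ss; have [sx s13 s23] := standard_matrices ss.
have nz := natf_neq0_char0 char0.
apply: (dim_Ext1_0 char0) => Z [c1 c2 c3].
have [x [y ZE]] : exists x y, Z = mx2 x y (- y) (- x).
  exists (Z 0 0), (Z 0 1); move: c1; rewrite sH rH st_H12.
  have -> : Z = mx2 (Z 0 0) (Z 0 1) (Z 1 0) (Z 1 1) by apply: mx2P.
  rewrite !mulmxE !mx2M mx2N => /mx2_inj[e1 e2 _ _].
  rewrite ?(mul0r, mul1r, mulr0, mulr1, add0r, addr0) in e1 e2.
  by rewrite e1 e2 !mxE.
suff [c [xE yE]] : exists c, x = c * (p - p') /\ y = c * (q - q').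
  exists c%:M; first by move=> t; rewrite sH rH mul_scalar_mx mul_mx_scalar.
  rewrite sx rx mul_scalar_mx mul_mx_scalar ZE xE yE.
  have mx2Z a b d e : c *: mx2 a b d e = mx2 (c * a) (c * b) (c * d) (c * e).
    by apply: mx2P; rewrite !mxE.
  by rewrite !mx2Z mx2N mx2D; apply: mx2_congr; ring.
rewrite ZE sx rx !mulmxE !mx2M mx2D mx2_0 in c2.
case/mx2_inj: c2 => f1 f2 _ _.
have [e|pp'] := eqVneq p p'; last first.
  exists (x / (p - p')); have d0 : p - p' != 0 by rewrite subr_eq0.
  split; first by field.
  apply: (mulfI d0); transitivity ((q - q') * x); last by field.
  apply/eqP; rewrite -subr_eq0 -f2; apply/eqP; ring.
have p0 : p != 0.
  apply: contra_eq_neq e5 => p0; rewrite p0 expr0n /= !mul0rn mul0r mul0rn subrr.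
  by rewrite eq_sym oppr_eq0 oner_neq0.
have qq' : q = q'.
  apply: (mulfI (mulf_neq0 p0 (nz 3))).
  have : p ^+ 2 *+ 5 - p * q *+ 4 = p' ^+ 2 *+ 5 - p' * q' *+ 4 by rewrite e5 e5'.
  rewrite -e => /addrI/oppr_inj h.
  by transitivity (p * q *+ 4); [|rewrite h]; ring.
subst p' q'; exists 0; rewrite !mul0r.
have {}f1 : p * x = q * y.
  apply: (mulfI (nz 1)); apply/eqP; rewrite -subr_eq0 -f1; apply/eqP; ring.
have f3 : (q * x + p * y) *+ 8 - p * x *+ 10 - q * y *+ 10 = 0.
  move: c3; rewrite /quadratic_part conj_family13 conj_family23 sx s13 s23 rx r13 r23.
  rewrite !sH !rH st_H13 st_H23 ZE !mulmxE !mx2M !mx2N !mx2M !mx2D mx2_0 => /mx2_inj[e _ _ _].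
  by rewrite -[RHS]e; ring.
have x0 : x = 0.
  apply: (mulfI (nz 3)); rewrite mulr0.
  (* A certificate: since 5 p^2 - 4 p q = -1, 4 x is a combination of [f3], [f1] and p^2 - q^2. *)
  transitivity (- 4%:R * x * (p ^+ 2 *+ 5 - p * q *+ 4)); first by rewrite e5; ring.
  transitivity (p * ((q * x + p * y) *+ 8 - p * x *+ 10 - q * y *+ 10)
    + (q *+ 8 - p *+ 10) * (p * x - q * y) - y *+ 8 * (p ^+ 2 - q ^+ 2)).
    by ring.
  by rewrite f3 f1 pq !subrr !mulr0 addr0 subr0.
split=> //; have q0 : q != 0.
  by apply: contraNneq p0 => q0; rewrite -sqrf_eq0 pq q0 expr0n.
by apply: (mulfI q0); rewrite -f1 x0 !mulr0.
Qed.
End StandardStandard.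
End ExtDimensions.

Theorem mainTheorem13 (k : closedFieldType) (char0 : [pchar k] =i pred0)
    (i : k) (i2 : i ^+ 2 = -1) :
  @is_Ext_quiver k (A1 k) 6 (A1_simples char0 i2)
    (fun s t : 'I_6 =>
       count_mem (s.+1, t.+1)
         [:: (1, 2); (2, 1); (1, 3); (1, 4); (3, 2); (4, 2);
             (2, 5); (2, 6); (5, 1); (6, 1)]%N).
Proof.
split; first exact: A1_complete_simples.
have neqN (a : k) : a != 0 -> a != - a.
  move=> a0; rewrite -addr_eq0 -mulr2n -mulr_natr mulf_neq0 //.
  exact: natf_neq0_char0.
have i0 := i_neq0 i2.
have i30 : i / 3%:R != 0 by rewrite mulf_neq0 ?invr_neq0 ?natf_neq0_char0.
move=> s t.
have [[r -> [cr s2]]|[r -> [sr s1]]] := A1_simplesP char0 i2 s;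
  have [[r' -> [cr' t2]]|[r' -> [sr' t1]]] := A1_simplesP char0 i2 t.
- case: s t cr cr' s2 t2 => -[|[|//]] lt_s [[|[|//]] lt_t] /= cr cr' _ _.
  + exact: (dim_Ext1_character_same char0 cr cr').
  + by apply: (dim_Ext1_character_diff char0 cr cr'); rewrite expr0 expr1.
  + by apply: (dim_Ext1_character_diff char0 cr cr'); rewrite expr0 expr1 opprK.
  + exact: (dim_Ext1_character_same char0 cr cr').
(* For concrete s and t the arrow count computes to 0 or 1, and only the lemma of that dimension
   applies; [neqN] refutes theta = - theta. *)
- case: s t cr sr' s2 t1 => -[|[|//]] lt_s [[|[|[|[|[|[|//]]]]]] lt_t] //= cr sr' _ _;
    first [apply: (dim_Ext1_character_standard_1 char0 cr sr');
           by rewrite /= ?expr1 ?expr0 ?mulN1r ?mul1r ?opprK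
          |apply: (dim_Ext1_character_standard_0 char0 cr sr');
           by rewrite /= ?expr1 ?expr0 ?mulN1r ?mul1r ?opprK ?neqN // eq_sym neqN].
- case: s t sr cr' s1 t2 => -[|[|[|[|[|[|//]]]]]] lt_s [[|[|//]] lt_t] //= sr cr' _ _;
    first [apply: (dim_Ext1_standard_character_1 char0 sr cr');
           by rewrite /= ?expr1 ?expr0 ?mulN1r ?mul1r ?opprK
          |apply: (dim_Ext1_standard_character_0 char0 sr cr');
           by rewrite /= ?expr1 ?expr0 ?mulN1r ?mul1r ?opprK ?neqN // eq_sym neqN].
- case: s t sr sr' s1 t1 => -[|[|[|[|[|[|//]]]]]] lt_s [[|[|[|[|[|[|//]]]]]] lt_t] //= sr sr' _ _;
    exact: (dim_Ext1_standard_standard char0 sr sr').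
Qed.
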